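(* Let $(W,S)$ be a Coxeter system with $W$ a finite Weyl group. Then for any $w\in W$ and any diameter $\{u,v\}$ of $[e,w]_R$: (1) $\operatorname{atom}([e,w]_R)=\operatorname{atom}([u,w]_R)+\operatorname{atom}([v,w]_R)$; (2) $\operatorname{coatom}([e,w]_R)=\operatorname{coatom}([e,u]_R)+\operatorname{coatom}([e,v]_R)$.
   Context: A finite Weyl group is a finite Coxeter group that is the Weyl group of a crystallographic root system, with $S$ the set of simple reflections; $e$ is the identity and $\ell$ the length function. The right weak order $\leq_R$ on $W$ is defined by $u\leq_R w$ iff $\ell(w)=\ell(u)+\ell(u^{-1}w)$; for $u\leq_R v$, $[u,v]_R=\{g\in W\mid u\leq_R g\leq_R v\}$. For such a non-empty interval, $\operatorname{atom}([u,v]_R)$ is the number of elements of $[u,v]_R$ that cover $u$, and $\operatorname{coatom}([u,v]_R)$ is the number of elements of $[u,v]_R$ that are covered by $v$ (in the order $\leq_R$). The word metric is $d(u,v)=\ell(u^{-1}v)$. A subset $\{u,v\}$ of $[e,w]_R$ is a diameter of $[e,w]_R$ if $d(u,v)=\ell(w)$. *)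

(* Defs.v *)
From HB Require Import structures.
From mathcomp Require Import all_boot all_order all_algebra.
From mathcomp Require Import all_fingroup all_character.
From mathcomp Require Import reals.

Set Implicit Arguments.
Unset Strict Implicit.
Unset Printing Implicit Defensive.

Import Order.TTheory GRing.Theory Num.Theory GroupScope.

Local Open Scope ring_scope.

Section RootSystems.
Variables (R : realType) (n : nat).
Implicit Types (a b : 'cV[R]_n) (Phi Delta : seq 'cV[R]_n).

Definition dotp a b : R := (a^T *m b) 0 0.

(* b |-> b - 2 (a, b) / (a, a) a, acting on column vectors from the left *)
Definition reflection_mx a : 'M[R]_n := 1%:M - (2 / dotp a a) *: (a *m a^T).

(* Finite sets of vectors are given by lists. *)
Definition crystallographic_root_system Phi : Prop :=
  [/\ 0 \notin Phi,
      <<Phi>>%VS = fullv,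
      {in Phi, forall a (c : R), c *: a \in Phi <-> c = 1 \/ c = -1},
      {in Phi &, forall a b, reflection_mx a *m b \in Phi} &
      {in Phi &, forall a b, 2 * dotp a b / dotp a a \is a Num.int}].

Definition nonneg_comb Delta b : Prop :=
  exists c : 'cV[R]_n -> nat, b = \sum_(a <- Delta) (c a)%:R *: a.

Definition simple_roots Phi Delta : Prop :=
  [/\ {subset Delta <= Phi}, basis_of fullv Delta &
      {in Phi, forall b, nonneg_comb Delta b \/ nonneg_comb Delta (- b)}].

End RootSystems.

Local Open Scope group_scope.

(* [W] is an abstract group; a faithful representation [rG] identifies it with
   the matrix group generated by the reflections in the roots. *)
Definition finite_weyl_group (R : realType) (W : finGroupType) (S : {set W}) :
    Prop :=
  exists (n : nat) (Phi Delta : seq 'cV[R]_n)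
         (rG : mx_representation R [set: W] n),
  [/\ crystallographic_root_system Phi /\ simple_roots Phi Delta,
      mx_faithful rG,
      {in Phi, forall a, exists x, rG x = reflection_mx a},
      <<[set x | rG x \in [seq reflection_mx a | a <- Phi]]>> = [set: W] &
      S = [set x | rG x \in [seq reflection_mx a | a <- Delta]]].

(* The presentation <S | s ^ 2, (s t) ^ m(s, t)>, where m(s, t) is the order of
   s t, stated as a universal property among all (possibly infinite) groups. *)
Definition coxeter_system (W : finGroupType) (S : {set W}) : Prop :=
  [/\ {in S, forall s, #[s] = 2%N},
      <<S>> = [set: W] &
      forall (H : groupType) (f : W -> H),
        {in S &, forall s t, (f s * f t) ^+ #[s * t] = 1} ->
        exists2 g : W -> H, {morph g : x y / x * y} & {in S, g =1 f}].

Section WeakOrder.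
Variables (W : finGroupType) (S : {set W}).
Implicit Types u v w x y : W.

(* [S ^+ k] is the set of all products of [k] elements of [S]. *)
Lemma word_ex w : exists k, (w \in S ^+ k) || (w \notin <<S>>).
Proof.
have [/gen_prodgP[k [c Sc ->]]|_] := boolP (w \in <<S>>); last by exists 0%N; rewrite orbT.
exists k; rewrite orbF; elim: k c Sc => [|k IHk] c Sc.
  by rewrite big_ord0 set11.
by rewrite big_ord_recl expgS mem_mulg ?Sc ?IHk.
Qed.

(* Junk value 0 outside <<S>>. *)
Definition cox_length w : nat := ex_minn (word_ex w).

Definition weak_le u w : bool :=
  cox_length w == (cox_length u + cox_length (u^-1 * w))%N.

Definition weak_covered u w : bool :=
  [&& u != w, weak_le u w &
      [forall x, weak_le u x && weak_le x w ==> (x == u) || (x == w)]].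

Definition weak_interval u v : {set W} := [set x | weak_le u x && weak_le x v].

Definition atom u v : nat := #|[set x in weak_interval u v | weak_covered u x]|.

Definition coatom u v : nat :=
  #|[set x in weak_interval u v | weak_covered x v]|.

Definition word_dist u v : nat := cox_length (u^-1 * v).

Definition is_diameter w u v : Prop :=
  [/\ u \in weak_interval 1 w, v \in weak_interval 1 w &
      word_dist u v = cox_length w].

End WeakOrder.

(* Main.v *)
(* A chamber [g] gives a sign to every root, and [d(g, h)] counts the walls
   separating [g] from [h]. A diameter says that the chambers of [e], [u], [w]
   and [v] form a rectangle: each root changes sign between none or exactly two
   opposite sides. With [D c g] the number of walls of the chamber [g] that
   separate it from [c], the atoms of [[u, w]] are counted by [D w u] and the
   coatoms of [[e, u]] by [D e u]. It suffices to show the corner inequality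
   [D c a + D c b <= D c o] for a corner [c] with neighbours [a], [b] and opposite
   corner [o]: the four inequalities of a rectangle add up to an equality.

   The roots fall into three colours: those separating [c] from [a], those
   separating [c] from [b], and those separating [c] from [- o]. No root is the
   sum of two roots such that all three colours occur. As for Gallai colourings of
   complete graphs, some colour does not span. By induction on the number of roots
   (the roots in the span of this colour, and an average over the group generated
   by its reflections) there are vectors with sum zero in the open chambers of
   [a], [b] and [- o]. They order the simple roots of these three systems that are
   negative for [c] so that, by integrality of the coordinates of roots, the matrix
   of these simple roots in dual bases is triangular. Hence these simple roots are
   independent, which is the corner inequality. *)
Require Import Defs.
From mathcomp Require Import all_boot all_order all_algebra.
From mathcomp Require Import all_fingroup all_character.
From mathcomp Require Import boolp reals.
From mathcomp Require Import lra ring zify.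

Set Implicit Arguments.
Unset Strict Implicit.
Unset Printing Implicit Defensive.

Import Order.TTheory GRing.Theory Num.Theory GroupScope.

Local Open Scope ring_scope.

(** * Root subsystems *)

Section DotProduct.
Variables (F : realType) (n : nat).
Implicit Types (x y z : 'cV[F]_n) (M : 'M[F]_n).

Lemma dotpE x y : dotp x y = \sum_i x i 0 * y i 0.
Proof. by rewrite /dotp mxE; apply: eq_bigr => i _; rewrite mxE. Qed.

Lemma dotpC x y : dotp x y = dotp y x.
Proof. by rewrite !dotpE; apply: eq_bigr => i _; rewrite mulrC. Qed.

Lemma dotpDr x y z : dotp x (y + z) = dotp x y + dotp x z.
Proof. by rewrite /dotp mulmxDr mxE. Qed.

Lemma dotpDl x y z : dotp (x + y) z = dotp x z + dotp y z.
Proof. by rewrite dotpC dotpDr !(dotpC z). Qed.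

Lemma dotpZr (c : F) x y : dotp x (c *: y) = c * dotp x y.
Proof. by rewrite /dotp -scalemxAr mxE. Qed.

Lemma dotpZl (c : F) x y : dotp (c *: x) y = c * dotp x y.
Proof. by rewrite dotpC dotpZr dotpC. Qed.

Lemma dotpNr x y : dotp x (- y) = - dotp x y.
Proof. by rewrite -scaleN1r dotpZr mulN1r. Qed.

Lemma dotpNl x y : dotp (- x) y = - dotp x y.
Proof. by rewrite dotpC dotpNr dotpC. Qed.

Lemma dotp0r x : dotp x 0 = 0.
Proof. by rewrite -(scale0r 0) dotpZr mul0r. Qed.

Lemma dotp0l x : dotp 0 x = 0.
Proof. by rewrite dotpC dotp0r. Qed.

Definition dotp_lin := (dotpDl, dotpDr, dotpNl, dotpNr, dotpZl, dotpZr).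

Lemma dotp_sumr (I : Type) (r : seq I) (P : pred I) (f : I -> 'cV[F]_n) x :
  dotp x (\sum_(i <- r | P i) f i) = \sum_(i <- r | P i) dotp x (f i).
Proof. by apply: (big_morph (dotp x) (dotpDr x) (dotp0r x)). Qed.

Lemma dotp_suml (I : Type) (r : seq I) (P : pred I) (f : I -> 'cV[F]_n) x :
  dotp (\sum_(i <- r | P i) f i) x = \sum_(i <- r | P i) dotp (f i) x.
Proof. by rewrite dotpC dotp_sumr; apply: eq_bigr => i _; rewrite dotpC. Qed.

Lemma dotp_ge0 x : 0 <= dotp x x.
Proof. by rewrite dotpE sumr_ge0 // => i _; rewrite -expr2 sqr_ge0. Qed.

Lemma dotp_eq0 x : (dotp x x == 0) = (x == 0).
Proof.
apply/idP/eqP => [|->]; last by rewrite dotp0r.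
rewrite dotpE psumr_eq0 => [/allP h|i _]; last by rewrite -expr2 sqr_ge0.
apply/colP => i; rewrite mxE.
by have := h i (mem_index_enum i); rewrite /= mulf_eq0 orbb => /eqP.
Qed.

Lemma dotp_gt0 x : (0 < dotp x x) = (x != 0).
Proof. by rewrite lt0r dotp_eq0 dotp_ge0 andbT. Qed.

Lemma reflectionE x y : reflection_mx x *m y = y - (2 * dotp x y / dotp x x) *: x.
Proof.
rewrite /reflection_mx mulmxBl mul1mx -scalemxAl -mulmxA.
rewrite [x^T *m y]mx11_scalar -/(dotp x y) mul_mx_scalar scalerA.
by congr (_ - _ *: _); ring.
Qed.

Lemma reflectionN x : reflection_mx (- x) = reflection_mx x.
Proof. by rewrite /reflection_mx !dotp_lin opprK linearN /= mulNmx mulmxN opprK. Qed.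

Lemma reflectionK x y : x != 0 -> reflection_mx x *m (reflection_mx x *m y) = y.
Proof.
rewrite -dotp_eq0 => xx; rewrite !reflectionE; set k := 2 * dotp x y / _.
have -> : 2 * dotp x (y - k *: x) / dotp x x = - k by rewrite !dotp_lin /k; field.
by rewrite scaleNr opprK subrK.
Qed.

Lemma dotp_span0 (X : seq 'cV[F]_n) p x :
  {in X, forall y, dotp p y = 0} -> x \in <<X>>%VS -> dotp p x = 0.
Proof.
move=> hX /(@coord_span _ _ _ (in_tuple X)) ->.
rewrite dotp_sumr big1 // => i _; rewrite dotpZr hX ?mulr0 //.
exact: mem_nth.
Qed.

End DotProduct.

(* Inherited by the intersections of a root system with subspaces. *)
Definition root_subsystem (F : realType) (n : nat) (Psi : seq 'cV[F]_n) : Prop :=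
  [/\ 0 \notin Psi,
      {in Psi, forall x, - x \in Psi},
      {in Psi &, forall x y, reflection_mx x *m y \in Psi},
      {in Psi &, forall x y, 2 * dotp x y / dotp x x \is a Num.int} &
      {in Psi &, forall x y, dotp x y < 0 -> x + y != 0 -> x + y \in Psi}].

Section Subsystem.
Variables (F : realType) (n : nat) (Psi : seq 'cV[F]_n).
Hypothesis sysPsi : root_subsystem Psi.
Implicit Types x y z s : 'cV[F]_n.

Lemma root_neq0 x : x \in Psi -> x != 0.
Proof. by case: sysPsi => h0 _ _ _ _; apply: contraL => /eqP->. Qed.

Lemma mem_rootN x : (- x \in Psi) = (x \in Psi).
Proof.
by case: sysPsi => _ hN _ _ _; apply/idP/idP => /hN //; rewrite opprK.
Qed.

Lemma root_sub x y : x \in Psi -> y \in Psi -> 0 < dotp x y -> x != y ->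
  x - y \in Psi.
Proof.
case: sysPsi => _ _ _ _ hP hx hy h xy; apply: hP => //; rewrite ?mem_rootN //.
  by rewrite dotpNr oppr_lt0.
by rewrite subr_eq0.
Qed.

(** With [w = x + y + z], a failure of both alternatives makes [(x, z)], [(y, z)], [(w, - x)] and
    [(w, - y)] non-negative, because [w - y = x + z] and [w - x = y + z]. Then
    [(x + y, x + y) <= 0], although [x + y] is a root. *)
Lemma three_roots x y z : x \in Psi -> y \in Psi -> z \in Psi ->
    x + y \in Psi -> x + y + z \in Psi ->
  (x + z == 0) || (x + z \in Psi) || ((y + z == 0) || (y + z \in Psi)).
Proof.
case: sysPsi => _ _ _ _ hP hx hy hz hxy hw.
rewrite -[X in is_true X]negbK !negb_or; apply/negP => /andP[/andP[xz0 xzR] /andP[yz0 yzR]].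
have le1 a b : a \in Psi -> b \in Psi -> a + b != 0 -> a + b \notin Psi -> 0 <= dotp a b.
  by move=> ha hb n0; rewrite leNgt; apply: contraNN => /hP; apply.
have xz := le1 x z hx hz xz0 xzR; have yz := le1 y z hy hz yz0 yzR.
have ex : x + y + z - y = x + z by rewrite addrAC addrK.
have ey : x + y + z - x = y + z by rewrite addrAC [x + y]addrC addrK.
have wy : 0 <= dotp (x + y + z) (- y) by apply: le1; rewrite ?mem_rootN ?ex.
have wx : 0 <= dotp (x + y + z) (- x) by apply: le1; rewrite ?mem_rootN ?ey.
have := root_neq0 hxy; rewrite -dotp_gt0.
rewrite !dotp_lin in wx wy *; rewrite (dotpC z x) (dotpC z y) (dotpC y x) in wx wy *.
lra.
Qed.

(* Root strings: the steps below the middle come from the sign of the inner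
   product, those above it from the reflection. *)
Lemma string_closed (Y : pred 'cV[F]_n) y s :
    {subset Y <= Psi} -> s \in Psi -> s \notin Y -> - s \notin Y ->
    {in Y, forall z, (z + s \in Psi -> z + s \in Y) /\
                     (z - s \in Psi -> z - s \in Y)} ->
  y \in Y -> reflection_mx s *m y \in Y.
Proof.
move=> sY; wlog : s / 0 <= 2 * dotp s y / dotp s s.
  move=> h hs nY nNY cl hy; case: (leP 0 (2 * dotp s y / dotp s s)) => [k0|k0].
    exact: h.
  rewrite -reflectionN; apply: h; rewrite ?mem_rootN ?opprK //.
    by rewrite !dotpNl dotpNr opprK mulrN mulNr oppr_ge0 ltW.
  by move=> z /cl[h1 h2]; split.
move=> k0 hs nY nNY cl hy; case: (sysPsi) => h0 _ hr hint hP.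
have ss : 0 < dotp s s by rewrite dotp_gt0 root_neq0.
have /natrP[m hm] : 2 * dotp s y / dotp s s \is a Num.nat.
  by rewrite natrEint k0 hint // sY.
have hsy : 2 * dotp s y = m%:R * dotp s s by rewrite -hm mulfVK // gt_eqF.
suff str j : (j <= m)%N -> y - j%:R *: s \in Y by rewrite reflectionE hm str.
elim/ltn_ind: j => [[|j] IH] jm; first by rewrite scale0r subr0.
have hj : y - j%:R *: s \in Y by apply: IH => //; apply: ltnW.
have ej : y - j.+1%:R *: s = y - j%:R *: s - s.
  by rewrite -natr1 scalerDl scale1r opprD addrA.
rewrite ej; apply: (cl _ hj).2; case: (ltnP (j + j) m) => [lt|ge].
  apply: root_sub; [exact: sY|by []| |].
    rewrite !dotp_lin dotpC -(pmulr_rgt0 _ (ltr0n F 2)) mulrBr hsy mulrA -mulrBl.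
    by rewrite pmulr_lgt0 // subr_gt0 -natrM ltr_nat mul2n -addnn.
  by apply: contraNN nY => /eqP<-.
have hk : y - (m - j.+1)%:R *: s \in Y.
  by apply: IH; lia.
have -> : y - j%:R *: s - s = reflection_mx s *m (y - (m - j.+1)%:R *: s).
  rewrite reflectionE -ej !dotp_lin mulrBr hsy mulrBl mulfK ?gt_eqF //.
  rewrite mulrA mulfK ?gt_eqF // -addrA -opprD -scalerDl; congr (_ - _ *: _).
  by rewrite natrB //; ring.
by apply: hr => //; apply: sY.
Qed.

(** The reflection in [s] permutes the roots in [Y], so it fixes their sum, and a vector fixed by a
    reflection is orthogonal to its root. *)
Lemma sum_stable_orth (Y : pred 'cV[F]_n) s : uniq Psi -> {subset Y <= Psi} ->
    s \in Psi -> {in Y, forall y, reflection_mx s *m y \in Y} ->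
  dotp (\sum_(y <- Psi | y \in Y) y) s = 0.
Proof.
move=> uP sY hs st; set p := (X in dotp X s).
have ss : dotp s s != 0 by rewrite dotp_eq0 root_neq0.
have inv : cancel (mulmx (reflection_mx s)) (mulmx (reflection_mx s) : 'cV[F]_n -> _).
  by move=> y; rewrite reflectionK // (root_neq0 hs).
have rp : reflection_mx s *m p = p.
  rewrite /p -big_filter mulmx_sumr -(big_map (mulmx (reflection_mx s)) predT id).
  have st' y : y \in [seq y <- Psi | y \in Y] ->
      reflection_mx s *m y \in [seq y <- Psi | y \in Y].
    by rewrite !mem_filter => /andP[hy _]; rewrite st // sY // st.
  apply: perm_big; apply: uniq_perm; rewrite ?filter_uniq //.
    by rewrite map_inj_uniq ?filter_uniq //; apply: can_inj inv.
  move=> y; apply/mapP/idP => [[z hz ->]|hy]; first exact: st'.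
  by exists (reflection_mx s *m y); rewrite ?inv ?st'.
move: rp; rewrite reflectionE => /eqP; rewrite -subr_eq0 addrAC subrr add0r oppr_eq0.
rewrite scaler_eq0 (negPf (root_neq0 hs)) orbF dotpC mulf_eq0 invr_eq0 (negPf ss) orbF.
by rewrite mulf_eq0 pnatr_eq0 => /eqP.
Qed.

End Subsystem.

(** * Three-coloured root systems *)

(* In the application [p0], [p 0], [p 1] and [- p 2] lie in the chambers at
   a corner of a rectangle, at its two neighbours and at the opposite corner. *)
Definition sign_coloring (F : realType) (n : nat) (Psi : seq 'cV[F]_n)
    (p0 : 'cV[F]_n) (p : 'I_3 -> 'cV[F]_n) (col : 'cV[F]_n -> 'I_3) : Prop :=
  [/\ {in Psi, forall x, dotp p0 x != 0},
      {in Psi, forall x i, dotp (p i) x != 0} &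
      {in Psi, forall x i,
        (0 < dotp (p i) x) = (0 < dotp p0 x) (+) (i == col x)}].

Lemma third_color (b c : 'I_3) : b != c ->
  exists a, [/\ a != b, a != c & forall i, [|| i == a, i == b | i == c]].
Proof.
move=> bc; have /eqP/cards1P[a ea] : #|~: [set b; c]| = 1%N.
  by rewrite cardsCs setCK cards2 bc card_ord.
have ha i : (i == a) = (i != b) && (i != c).
  by have := in_set1 i a; rewrite -ea !inE negb_or => ->.
have := ha a; rewrite eqxx => /esym/andP[ab ac].
by exists a; split=> // i; rewrite ha; case: (i == b); case: (i == c).
Qed.

Section Coloring.
Variables (F : realType) (n : nat) (Psi : seq 'cV[F]_n).
Variables (p0 : 'cV[F]_n) (p : 'I_3 -> 'cV[F]_n) (col : 'cV[F]_n -> 'I_3).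
Hypotheses (sysPsi : root_subsystem Psi) (colP : sign_coloring Psi p0 p col).
Implicit Types (x y z : 'cV[F]_n) (a b c i : 'I_3).

Local Notation sg x := (0 < dotp p0 x).

Lemma sgN x : x \in Psi -> sg (- x) = ~~ sg x.
Proof.
case: colP => h _ _ /h h0; rewrite dotpNr oppr_gt0 -leNgt le_eqVlt.
by rewrite (negPf h0).
Qed.

Lemma colN x : x \in Psi -> col (- x) = col x.
Proof.
case: colP => _ h hc hx; have hNx : - x \in Psi by rewrite (mem_rootN sysPsi).
have := hc _ hx (col x); rewrite eqxx; have := hc _ hNx (col x); rewrite sgN //.
rewrite dotpNr oppr_gt0; have := h _ hx (col x).
case: ltgtP => // _ _; case: eqP => [-> //|_]; by case: (sg x).
Qed.

Lemma sgD x y : sg x = sg y -> x \in Psi -> y \in Psi -> sg (x + y) = sg x.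
Proof.
case: colP => h _ _ e hx hy; move: e; rewrite dotpDr.
have := h _ hx; have := h _ hy.
by case: (ltgtP 0 (dotp p0 x)) => //; case: (ltgtP 0 (dotp p0 y)) => //; lra.
Qed.

Lemma psgD x y i : (0 < dotp (p i) x) = (0 < dotp (p i) y) ->
  x \in Psi -> y \in Psi -> (0 < dotp (p i) (x + y)) = (0 < dotp (p i) x).
Proof.
case: colP => _ h _ e hx hy; move: e; rewrite dotpDr.
have := h _ hx i; have := h _ hy i.
by case: (ltgtP 0 (dotp (p i) x)) => //; case: (ltgtP 0 (dotp (p i) y)) => //; lra.
Qed.

(** Two roots on the same side of a vector have their sum on that side. If [x] and [y] have the same
    sign for [p0], then [p (col (x + y))] would flip only their sum. Otherwise [p (col x)] and
    [p (col y)] each align [x] with [y], and prescribe opposite signs for [x + y]. *)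
Lemma no_rainbow x y : x \in Psi -> y \in Psi -> x + y \in Psi ->
  col x != col y -> (col (x + y) == col x) || (col (x + y) == col y).
Proof.
move=> hx hy hz ne; case: colP => _ _ hc; apply/negPn; rewrite negb_or.
apply/negP => /andP[zx zy].
have hs i := @psgD x y i; have h0 := @sgD x y.
have := hs (col x); have := hs (col y); have := hs (col (x + y)); move: h0.
rewrite !hc // !eqxx (negPf ne) [col y == col x]eq_sym (negPf ne) (negPf zx) (negPf zy).
rewrite [col x == _]eq_sym (negPf zx) [col y == _]eq_sym (negPf zy).
by case: (sg x); case: (sg y); case: (sg (x + y)) => // h1 h2 h3 h4;
  (discriminate (h1 erefl hx hy) || discriminate (h2 erefl hx hy) ||
   discriminate (h3 erefl hx hy) || discriminate (h4 erefl hx hy)).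
Qed.

Lemma same_color_sum x y : x \in Psi -> y \in Psi -> x + y \in Psi ->
  col x = col y -> sg x = sg y -> col (x + y) = col x.
Proof.
move=> hx hy hz ec es; case: colP => _ _ hc.
have := @psgD x y (col x); have := sgD es hx hy.
rewrite !hc // -ec eqxx -es => -> /(_ erefl hx hy).
by case: (sg x); case: eqP => [->|].
Qed.

(** Exactly one of [p0] and [p (col y)] gives [x] and [y] the same sign, hence [x + y] the sign of
    [x]. Neither [x] nor [x + y] changes sign between the two. *)
Lemma same_color_sign x y : x \in Psi -> y \in Psi -> x + y \in Psi ->
  col (x + y) = col x -> col y != col x -> sg (x + y) = sg x.
Proof.
move=> hx hy hz ec ne; case: colP => _ _ hc.
have := @psgD x y (col y); have := @psgD x y (col x); have := @sgD x y.
rewrite !hc // ec !eqxx (negPf ne) eq_sym (negPf ne).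
by case: (sg x); case: (sg y); case: (sg (x + y)) => // h1 h2 h3;
  (discriminate (h1 erefl hx hy) || discriminate (h2 erefl hx hy) ||
   discriminate (h3 erefl hx hy)).
Qed.

Lemma color_step x y a c : x \in Psi -> y \in Psi -> x + y \in Psi ->
  col x = c -> col y = a -> a != c -> (col (x + y) == a) || (col (x + y) == c).
Proof.
move=> hx hy hz <- <- ne; rewrite orbC; apply: no_rainbow => //; by rewrite eq_sym.
Qed.

Lemma color_diff x y b c : x \in Psi -> y \in Psi -> x + y \in Psi ->
  col (x + y) = c -> col y = b -> b != c -> (col x == b) || (col x == c).
Proof.
move=> hx hy hz ec eb ne; have hNy : - y \in Psi by rewrite (mem_rootN sysPsi).
have := @color_step (x + y) (- y) b c; rewrite addrK; apply => //.
by rewrite colN.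
Qed.

(** Says by orthogonality that the roots of colour [a] span the same subspace as [Psi]. *)
Definition spanning a : Prop :=
  forall q, {in Psi, forall s, col s = a -> dotp q s = 0} ->
    {in Psi, forall x, dotp q x = 0}.

(** Colours are invariant under negation, so these are the elements of the lattice generated by the
    roots of colour [a]. *)
Definition color_sum a x : Prop :=
  exists ss : seq 'cV[F]_n,
    all (fun s => (s \in Psi) && (col s == a)) ss /\ x = \sum_(s <- ss) s.

Lemma color_sumD a x s : color_sum a x -> s \in Psi -> col s = a ->
  color_sum a (x + s).
Proof.
move=> [ss [hss ->]] hs cs; exists (s :: ss); split; last by rewrite big_cons addrC.
by rewrite /= hs cs eqxx.
Qed.

(** Otherwise let [Y] be the positive roots of the colour of [x] outside the lattice. It is stable
    under the reflections in roots of colour [a], so its sum [q] is orthogonal to these, hence to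
    all of [Psi] and to itself. But [q] is positive for [p0]. *)
Lemma spanning_color_sum a x : uniq Psi -> spanning a -> x \in Psi ->
  col x != a -> color_sum a x.
Proof.
move=> uP sp; wlog sx : x / sg x.
  move=> h hx cx; case sx : (sg x); first exact: h.
  have [||| ss [hss e]] := h (- x); rewrite ?(mem_rootN sysPsi) ?colN ?sgN ?sx //.
  exists [seq - s | s <- ss]; split.
    rewrite all_map; apply: sub_all hss => s /andP[hs cs] /=.
    by rewrite (mem_rootN sysPsi) // hs colN.
  by rewrite big_map sumrN -e opprK.
move=> hx cx; apply: contrapT => nx; set c := col x in cx.
pose Y := [pred y | [&& y \in Psi, sg y, col y == c & ~~ `[< color_sum a y >]]].
have sY : {subset Y <= Psi} by move=> y /and4P[].
have step y s : y \in Y -> s \in Psi -> col s = a -> y + s \in Psi -> y + s \in Y.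
  move=> /and4P[hy sy /eqP cy /asboolPn ny] hs cs hys; apply/and4P.
  have nys : ~ color_sum a (y + s).
    move=> h; apply: ny; rewrite -[y](addrK s); apply: color_sumD => //.
      by rewrite (mem_rootN sysPsi).
    by rewrite colN.
  have cys : col (y + s) = c.
    have := @color_step y s a c hy hs hys cy cs.
    rewrite eq_sym => /(_ cx)/orP[]/eqP // e; case: nys.
    by exists [:: y + s]; rewrite /= hys e eqxx big_seq1.
  split=> //; last exact/asboolPn; last by rewrite cys.
  by rewrite same_color_sign // ?cy ?cys // cs eq_sym.
pose q := \sum_(y <- Psi | y \in Y) y.
have qs : {in Psi, forall s, col s = a -> dotp q s = 0}.
  move=> s hs cs; apply: sum_stable_orth => // y hy.
  have hNs : - s \in Psi by rewrite (mem_rootN sysPsi).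
  apply: (@string_closed _ _ Psi sysPsi Y) => //.
  - by apply/negP => /and4P[_ _]; rewrite cs eq_sym (negPf cx).
  - by apply/negP => /and4P[_ _]; rewrite colN // cs eq_sym (negPf cx).
  by move=> z hz; split=> h; apply: step => //; rewrite colN.
have := sp q qs => q0.
have : dotp q q = 0.
  by rewrite {2}/q dotp_sumr big1_seq // => y /andP[_ /q0].
move/eqP; rewrite dotp_eq0 => /eqP qz.
have : 0 < dotp p0 q.
  rewrite /q dotp_sumr (big_rem x) //=.
  have -> : x \in Y by apply/and4P; split=> //; exact/asboolPn.
  rewrite ltr_pwDl // sumr_ge0 // => y /and4P[_ /ltW //].
by rewrite qz dotp0r ltxx.
Qed.

End Coloring.

Lemma seq_argmax (disp : Order.disp_t) (O : orderType disp) (T : eqType)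
    (f : T -> O) (s : seq T) (u0 : T) : u0 \in s ->
  exists2 u : T, u \in s & {in s, forall v : T, f v <= f u}%O.
Proof.
elim: s u0 => // u s IH u0 _; case: s IH => [|v s] IH.
  by exists u; rewrite ?mem_head // => z; rewrite inE => /eqP->.
have [y hy my] := IH v (mem_head _ _).
case: (leP (f u) (f y)) => h.
  by exists y => [|z]; rewrite in_cons ?hy ?orbT // => /orP[/eqP->|/my].
exists u => [|z]; rewrite ?mem_head // in_cons => /orP[/eqP->|/my] //.
by move/le_trans; apply; apply: ltW.
Qed.

Section NonSpanning.
Variables (F : realType) (n : nat) (Psi : seq 'cV[F]_n).
Variables (p0 : 'cV[F]_n) (p : 'I_3 -> 'cV[F]_n) (col : 'cV[F]_n -> 'I_3).
Hypotheses (sysPsi : root_subsystem Psi) (colP : sign_coloring Psi p0 p col).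
Hypothesis uniqPsi : uniq Psi.
Implicit Types (x y z g h s t : 'cV[F]_n) (a b c i : 'I_3).

Local Notation sg x := (0 < dotp p0 x).
Local Notation monochrome a ss :=
  (all (fun s => (s \in Psi) && (col s == a)) ss).

(** One peeling step. [three_roots] for [g - h], [h], [t] makes [t + h] or [g - h + t] a root, as
    the colours exclude a zero sum; [no_rainbow] then leaves four cases. *)
Lemma fork a b c g t h : a != b -> a != c -> b != c ->
    g \in Psi -> col g = c -> t \in Psi -> col t = b ->
    g + t \in Psi -> col (g + t) = c -> h \in Psi -> col h = a ->
    0 < dotp g h ->
  g - h \in Psi /\
  [\/ t + h \in Psi /\ col (t + h) = a,
      [/\ t + h \in Psi, col (t + h) = b & col (g - h) = c],
      [/\ g - h + t \in Psi, col (g - h + t) = a & col (g - h) = a] |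
      [/\ g - h + t \in Psi, col (g - h + t) = c & col (g - h) = c]].
Proof.
move=> ab ac bc hg cg ht ct hgt cgt hh ch gh.
have hNh : - h \in Psi by rewrite (mem_rootN sysPsi).
have cNh : col (- h) = a by rewrite (colN sysPsi colP).
have hgh : g - h \in Psi.
  by apply: (root_sub sysPsi) => //; apply: contraNneq ac => e; rewrite -ch -e cg.
split=> //.
have cgh : (col (g - h) == a) || (col (g - h) == c).
  exact: (color_step colP hg hNh).
have e1 : g - h + h + t = g + t by rewrite subrK.
have e2 : g - h + t + h = g + t by rewrite addrAC subrK.
have := three_roots sysPsi hgh hh ht; rewrite subrK => /(_ hg hgt).
case/orP=> /orP[].
- rewrite addr_eq0 => /eqP e; move: cgh; rewrite e (colN sysPsi colP) // ct.
  by rewrite (negPf bc) eq_sym (negPf ab).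
- move=> hght; have : (col (g - h + t) == a) || (col (g - h + t) == c).
    have -> : g - h + t = g + t - h by rewrite addrAC.
    by apply: (color_step colP hgt hNh); rewrite // addrAC.
  case/orP=> /eqP cc.
    have : (col (g - h) == b) || (col (g - h) == a).
      by apply: (color_diff sysPsi colP hgh ht); rewrite // eq_sym.
    case/orP=> /eqP cg'; last by constructor 3.
    by move: cgh; rewrite cg' (negPf bc) eq_sym (negPf ab).
  have : (col (g - h) == b) || (col (g - h) == c).
    exact: (color_diff sysPsi colP hgh ht).
  case/orP=> /eqP cg'; last by constructor 4.
  by move: cgh; rewrite cg' (negPf bc) eq_sym (negPf ab).
- rewrite addr_eq0 => /eqP e; move: ab.
  by rewrite -ch e (colN sysPsi colP) // ct eqxx.
rewrite [h + t]addrC => hth; have : (col (t + h) == a) || (col (t + h) == b).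
  exact: (color_step colP ht hh).
case/orP=> /eqP cc; first by constructor 1.
constructor 2; split=> //.
have : (col (g - h) == b) || (col (g - h) == c).
  have e : g - h + (t + h) = g + t by rewrite [t + h]addrC addrA subrK.
  by apply: (color_diff sysPsi colP hgh hth); rewrite ?e.
case/orP=> /eqP cg' //.
by move: cgh; rewrite cg' (negPf bc) eq_sym (negPf ab).
Qed.

(** The inner products of [g] with the summands add up to [(g, g) > 0], so one of them is
    positive. *)
Lemma peel a g ss : g \in Psi -> monochrome a ss -> g = \sum_(s <- ss) s ->
  exists2 h, 0 < dotp g h & [/\ h \in ss, h \in Psi, col h = a,
    monochrome a (rem h ss) & g - h = \sum_(s <- rem h ss) s].
Proof.
move=> hg hss e; have : 0 < dotp g g by rewrite dotp_gt0 (root_neq0 sysPsi).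
rewrite {2}e dotp_sumr => pos.
have /hasP[h hh gh] : has (fun h => 0 < dotp g h) ss.
  apply: contraLR pos => /hasPn np; rewrite -leNgt big_seq sumr_le0 // => s /np.
  by rewrite -leNgt.
have /andP[hP /eqP hc] := allP hss _ hh.
exists h => //; split=> //; first by apply/allP => s /mem_rem /(allP hss).
by rewrite e (big_rem h) //= addrAC subrr add0r.
Qed.

(* [x] and [x + t] both of colour [a] is called a witness below. A shortest
   expression of [g] or [g + t] as a sum of roots of colour [a] is peeled off
   one term at a time; each term is removed from [g] and either added to [t] or
   removed from [g + t], and any change of colour on the way would yield a
   shorter expression. *)
Lemma no_color_sum a b c t : a != b -> a != c -> b != c ->
    t \in Psi -> col t = b ->
    {in Psi, forall x, col x = a -> x + t \in Psi -> col (x + t) != a} ->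
  forall g, g \in Psi -> col g = c -> g + t \in Psi -> col (g + t) = c ->
  ~ color_sum Psi col a g.
Proof.
move=> ab ac bc ht ct nw g hg cg hgt cgt [ss []].
have [k] := ubnP (size ss); elim: k => // k IHk in g hg cg hgt cgt ss *.
rewrite ltnS => sk hss e.
(* Induction for [- (g + t)], whose sum with [t] is [- g]. *)
have short tt : (size tt < size ss)%N -> monochrome a tt ->
    g + t <> \sum_(s <- tt) s.
  move=> st htt ett; apply: (IHk (- (g + t)) _ _ _ _ [seq - s | s <- tt]).
  - by rewrite (mem_rootN sysPsi).
  - by rewrite (colN sysPsi colP).
  - by rewrite opprD subrK (mem_rootN sysPsi).
  - by rewrite opprD subrK (colN sysPsi colP).
  - by rewrite size_map (leq_trans st).
  - rewrite all_map; apply: sub_all htt => s /andP[hs cs] /=.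
    by rewrite (mem_rootN sysPsi) hs (colN sysPsi colP).
  by rewrite big_map sumrN -ett.
(* Invariant: [rest] sums to [g1], and [moved] lists the terms taken off [g + t] to reach [g1 + t1].
   The other terms taken off [g] have gone into [t1]. The strict bound on the sizes makes the
   expressions of [g + t] found below short enough for [short]. *)
have loop m g1 t1 rest moved : (size rest < m)%N ->
    (size rest + size moved < size ss)%N ->
    monochrome a rest -> monochrome a moved ->
    g1 \in Psi -> col g1 = c -> t1 \in Psi -> col t1 = b ->
    g1 + t1 \in Psi -> col (g1 + t1) = c ->
    g1 = \sum_(s <- rest) s -> g + t = g1 + t1 + \sum_(s <- moved) s -> False.
  elim: m => // m IHm in g1 t1 rest moved *; rewrite ltnS => rm szs hr hm.
  move=> hg1 cg1 ht1 ct1 hgt1 cgt1 e1 e2.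
  have [h gh [hin hh ch hr' er']] := peel hg1 hr e1.
  have szr : size rest = (size (rem h rest)).+1.
    by rewrite size_rem // prednK //; case: (rest) hin.
  have [hgh] := fork ab ac bc hg1 cg1 ht1 ct1 hgt1 cgt1 hh ch gh.
  have eg : g1 + t1 = g1 - h + t1 + h by rewrite [RHS]addrAC subrK.
  have eg' : g1 + t1 = g1 - h + (t1 + h) by rewrite eg addrA.
  case=> [[hth cth]|[hth cth cgh]|[hght cght cgh]|[hght cght cgh]].
  - apply: (short ((t1 + h) :: rem h rest ++ moved)).
    + by rewrite /= size_cat -addSn -szr.
    + by rewrite /= hth cth eqxx all_cat hr' hm.
    by rewrite e2 big_cons big_cat /= -er' eg' -addrA addrCA !addrA.
  - apply: (IHm (g1 - h) (t1 + h) (rem h rest) moved) => //; rewrite -?eg' //.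
    + by rewrite -szr.
    + by apply: leq_ltn_trans szs; rewrite leq_add2r szr leqnSn.
  - have r2 : (1 < size rest)%N.
      rewrite szr ltnS lt0n size_eq0; apply/eqP => rn.
      by move: er' (root_neq0 sysPsi hgh); rewrite rn big_nil => ->; rewrite eqxx.
    apply: (short (g1 - h + t1 :: h :: moved)).
    + by rewrite /=; apply: leq_ltn_trans szs; rewrite -add2n leq_add2r.
    + by rewrite /= hght cght hh ch !eqxx.
    by rewrite e2 !big_cons eg -addrA.
  apply: (IHm (g1 - h) t1 (rem h rest) (h :: moved)) => //.
  + by rewrite -szr.
  + by rewrite /= addnS -addSn -szr.
  + by rewrite /= hh ch eqxx.
  by rewrite big_cons e2 eg -!addrA.
(* The first term is peeled off outside the loop, whose strict bound fails while all of [ss] is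
   left. Here a sum of colour [a] is a witness for [t] itself, and the last case gives a shorter
   expression for [g - h]. *)
have [h gh [hin hh ch hr' er']] := peel hg hss e.
have szr : size ss = (size (rem h ss)).+1.
  by rewrite size_rem // prednK //; case: (ss) hin.
have [hgh] := fork ab ac bc hg cg ht ct hgt cgt hh ch gh.
have eg' : g + t = g - h + (t + h) by rewrite [t + h]addrC addrA subrK.
case=> [[hth cth]|[hth cth cgh]|[hght cght cgh]|[hght cght cgh]].
- by have := nw h hh ch; rewrite addrC hth cth eqxx => /(_ isT).
- apply: (loop (size ss) (g - h) (t + h) (rem h ss) [::]) => //; rewrite -?eg' //.
  + by rewrite szr.
  + by rewrite addn0 szr.
  by rewrite big_nil addr0.
- by have := nw (g - h) hgh cgh hght; rewrite cght eqxx.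
by apply: (IHk (g - h) hgh cgh hght cght (rem h ss)); rewrite // -szr.
Qed.

(** As [a] spans, [g] is a sum of roots of colour [a], which [no_color_sum] forbids in the absence
    of a witness. *)
Lemma witness_transfer a b c t g : a != b -> a != c -> b != c ->
    spanning Psi col a -> t \in Psi -> col t = b ->
    g \in Psi -> col g = c -> g + t \in Psi -> col (g + t) = c ->
  exists x, [/\ x \in Psi, col x = a, x + t \in Psi & col (x + t) = a].
Proof.
move=> ab ac bc sp ht ct hg cg hgt cgt; apply: contrapT => nx.
apply: (@no_color_sum a b c t ab ac bc ht ct _ g) => //.
  move=> x hx cx hxt; apply/negP => /eqP cxt; apply: nx; by exists x.
apply: (spanning_color_sum sysPsi colP) => //; by rewrite cg eq_sym.
Qed.

(* Let [th] be the highest root, of colour [c], and let [y] be the highest root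
   of another colour that is not orthogonal to [th]. Then [y] is the difference
   of the roots [th] and [th - y] of colour [c], hence also of two roots of the
   third colour, and the larger of these contradicts the choice of [y]. *)
Lemma not_all_spanning : Psi != [::] -> exists a, ~ spanning Psi col a.
Proof.
move=> nP; apply: contrapT => /forallNP allsp.
have sp a : spanning Psi col a by have /contrapT := allsp a.
have [u0 hu0] : exists u, u \in Psi by case: (Psi) nP => // u s _; exists u; rewrite mem_head.
have [th hth mth] := seq_argmax (dotp p0) hu0.
have sgth : sg th.
  case: (colP) => h _ _; have := mth _ (etrans (mem_rootN sysPsi th) hth).
  by rewrite dotpNr; have := h _ hth; case: ltgtP => // ? _; lra.
have thpos x : x \in Psi -> sg x -> 0 <= dotp th x.
  case: (sysPsi) => _ _ _ _ hP hx sx; rewrite leNgt; apply/negP => neg.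
  case: (eqVneq (th + x) 0) => [/eqP|n0].
    rewrite addr_eq0 => /eqP e; move: sgth; rewrite e dotpNr oppr_gt0 => /lt_trans /(_ sx).
    by rewrite ltxx.
  by have := mth _ (hP _ _ hth hx neg n0); rewrite dotpDr; lra.
set c := col th.
have [a0 na0] : exists a0, a0 != c.
  by case: (eqVneq c ord0) => [->|nc]; [exists ord_max | exists ord0; rewrite eq_sym].
pose X := [seq x <- Psi | (col x != c) && (0 < dotp th x)].
(* Colour [a0] spans, so not all its roots are orthogonal to [th]. *)
have [y1 hy1] : exists y, y \in X.
  apply: contrapT => nX; have := sp a0 th _ th hth.
  move=> h; have : dotp th th = 0.
    apply: h => s hs cs; apply/eqP; rewrite eq_le !leNgt; apply/andP; split; apply/negP => q.
      by apply: nX; exists s; rewrite mem_filter hs q cs na0.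
    apply: nX; exists (- s); rewrite mem_filter (mem_rootN sysPsi) hs (colN sysPsi colP) //.
    by rewrite cs na0 dotpNr oppr_gt0 q.
  by move/eqP; rewrite dotp_eq0 (negPf (root_neq0 sysPsi hth)).
have [y hy my] := seq_argmax (dotp p0) hy1.
move: hy; rewrite mem_filter => /andP[/andP[cy thy] hy].
have [a [ab ac _]] := third_color cy.
have hd : th - y \in Psi.
  by apply: (root_sub sysPsi) => //; apply: contraNneq cy => <-.
have sy : sg y.
  case: (colP) => h _ _; have := mth _ hd; rewrite dotpDr dotpNr.
  by have := h _ hy; case: ltgtP => //; lra.
have cd : col (th - y) = c.
  have : (col (th - y) == col y) || (col (th - y) == c).
    by apply: (color_diff sysPsi colP hd hy); rewrite ?subrK.
  case/orP=> /eqP // cd; case: (eqVneq (dotp p0 (th - y)) 0) => [z|nz].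
    by case: (colP) => h _ _; have := h _ hd; rewrite z eqxx.
  have sd : sg (th - y).
    rewrite lt0r nz /= dotpDr dotpNr subr_ge0; exact: mth.
  have := same_color_sum colP hd hy; rewrite subrK sd sy cd => /(_ hth erefl erefl) e.
  by move: cy; rewrite -e eqxx.
have hty : th - y + y \in Psi by rewrite subrK.
have cty : col (th - y + y) = c by rewrite subrK.
have [x [hx cx hxy cxy]] := witness_transfer ab ac cy (sp a) hy erefl hd cd hty cty.
have ssx : sg (x + y) = sg x.
  by apply: (same_color_sign colP); rewrite // ?cxy ?cx // eq_sym.
(* If [x] is positive, [x + y] is higher than [y]; otherwise [- x = - (x + y) + y] is. Both are in
   [X], since a positive root has non-negative inner product with [th]. *)
case sx : (sg x).
  have := my (x + y); rewrite mem_filter hxy cxy ac dotpDr.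
  rewrite ltr_wpDl // ?thpos // => /(_ isT); rewrite dotpDr.
  by move: sx; lra.
have hNxy : - (x + y) \in Psi by rewrite (mem_rootN sysPsi).
have sN : sg (- (x + y)) by rewrite (sgN colP) // ssx sx.
have e : - x = - (x + y) + y by rewrite opprD addrNK.
have := my (- x); rewrite mem_filter (mem_rootN sysPsi) hx (colN sysPsi colP) // cx ac e dotpDr.
rewrite ltr_wpDl // ?thpos // => /(_ isT); rewrite dotpDr.
by move: sN; lra.
Qed.

End NonSpanning.

(** * Vectors with sum zero in three chambers *)

Lemma small_perturbation (F : realType) (s : seq (F * F)) :
  exists2 e, 0 < e &
    forall d, 0 < d <= e -> {in s, forall ab, 0 < ab.1 -> 0 < ab.1 + d * ab.2}.
Proof.
elim: s => [|[a b] s [e e0 he]]; first by exists 1.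
have b0 : 0 < `|b| + 1 by rewrite ltr_wpDl.
case: (ltP 0 a) => a0; last first.
  exists e => // d /he h ab; rewrite inE => /orP[/eqP->/=|/h //].
  by rewrite ltNge a0.
exists (Num.min e (a / (`|b| + 1))); first by rewrite lt_min e0 divr_gt0.
move=> d; rewrite le_min => /and3P[d0 de da] ab.
rewrite inE => /orP[/eqP-> /= _|hab]; last by apply: (he d) => //; rewrite d0.
have h1 : d * `|b| < a.
  move: da; rewrite ler_pdivlMr // mulrDr mulr1; lra.
have : d * - `|b| <= d * b by rewrite ler_pM2l // lerNl -normrN ler_norm.
by rewrite mulrN; lra.
Qed.

Lemma small_perturbation_fin (F : realType) (I : finType) (T : eqType) (s : seq T)
    (f g : I -> T -> F) :
  exists2 e, 0 < e &
    forall i, {in s, forall x, 0 < f i x -> 0 < f i x + e * g i x}.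
Proof.
have [e e0 he] := small_perturbation [seq (f i x, g i x) | i <- enum I, x <- s].
exists e => // i x hx; apply: (he e _ (f i x, g i x)); first by rewrite e0 lexx.
by apply: allpairs_f; rewrite ?mem_enum.
Qed.

Section Balanced.
Variables (F : realType) (n : nat) (W : finGroupType).
Variable rG : mx_representation F [set: W] n.
Hypothesis orthG : forall g x y, dotp (rG g *m x) (rG g *m y) = dotp x y.
Implicit Types (x y s : 'cV[F]_n) (g h : W) (Psi : seq 'cV[F]_n).

Lemma rG_M g h x : rG (g * h)%g *m x = rG g *m (rG h *m x).
Proof. by rewrite repr_mxM ?inE // mulmxA. Qed.

Lemma rG_1 x : rG 1%g *m x = x.
Proof. by rewrite repr_mx1 mul1mx. Qed.

Lemma dotp_rG g x y : dotp (rG g *m x) y = dotp x (rG g^-1%g *m y).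
Proof. by rewrite -(orthG g^-1%g) -rG_M mulVg rG_1. Qed.

Section Average.
Variables (Psi : seq 'cV[F]_n) (p0 : 'cV[F]_n) (p : 'I_3 -> 'cV[F]_n).
Variables (col : 'cV[F]_n -> 'I_3) (c : 'I_3).
Hypotheses (sysPsi : root_subsystem Psi) (colP : sign_coloring Psi p0 p col).
Hypothesis reflPsi : {in Psi, forall s, exists g, rG g = reflection_mx s}.

Let U := <<[seq s <- Psi | col s == c]>>%VS.
Let G := <<[set g | has (fun s => (col s == c) && (rG g == reflection_mx s)) Psi]>>%g.
Let avg (q : 'cV[F]_n) := \sum_(g in G) rG g *m q.

(** Left multiplication by a reflection in a root of colour [c] permutes [G], so this reflection
    fixes the sum over [G], which is therefore orthogonal to the root. *)
Lemma avg_orth q x : x \in U -> dotp (avg q) x = 0.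
Proof.
apply: dotp_span0 => s; rewrite mem_filter => /andP[/eqP cs hs].
have [g hg] := reflPsi hs.
have gG : g \in G.
  by apply: mem_gen; rewrite inE; apply/hasP; exists s; rewrite // cs hg !eqxx.
have : rG g *m avg q = avg q.
  rewrite /avg mulmx_sumr [RHS](reindex_inj (mulgI g)) /=.
  by apply: eq_big => [h|h _]; rewrite ?groupMl // rG_M.
rewrite hg reflectionE => /eqP.
rewrite -subr_eq0 addrAC subrr add0r oppr_eq0 scaler_eq0 (negPf (root_neq0 sysPsi hs)) orbF.
rewrite mulf_eq0 invr_eq0 dotp_eq0 (negPf (root_neq0 sysPsi hs)) orbF mulf_eq0 pnatr_eq0 /=.
by rewrite dotpC => /eqP.
Qed.

(* Moving a root outside [U] by roots of colour [c] never makes it of colour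
   [c], hence changes neither its colour nor its sign. *)
Lemma orbit_color g x : g \in G -> x \in Psi -> x \notin U ->
  [/\ rG g *m x \in Psi, rG g *m x \notin U, col (rG g *m x) = col x &
      (0 < dotp p0 (rG g *m x)) = (0 < dotp p0 x)].
Proof.
move=> /gen_prodgP[k [f hf ->]] hx xU; elim: k f hf => [|k IH] f hf.
  by rewrite big_ord0 rG_1.
rewrite big_ord_recl rG_M; have [|] := IH (fun i => f (lift ord0 i)); first by [].
set y := _ *m x => hy yU <- <-.
have := hf ord0; rewrite inE => /hasP[s hs /andP[/eqP cs /eqP->]].
pose Y := [pred z | [&& z \in Psi, z \notin U, col z == col y &
  (0 < dotp p0 z) == (0 < dotp p0 y)]].
have ncU z : z \in Psi -> z \notin U -> col z != c.
  move=> hz; apply: contraNneq => cz; apply: memv_span.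
  by rewrite mem_filter cz eqxx.
have hNs : - s \in Psi by rewrite (mem_rootN sysPsi).
have cNs : col (- s) = c by rewrite (colN sysPsi colP).
have step z t : z \in Y -> t \in Psi -> col t = c -> z + t \in Psi -> z + t \in Y.
  move=> /and4P[hz zU /eqP cz /eqP sz] ht ct hzt.
  have tU : t \in U by apply: memv_span; rewrite mem_filter ct eqxx.
  have ztU : z + t \notin U by apply: contra zU => h; rewrite -[z](addrK t) rpredB.
  have czt : col (z + t) = col y.
    have cy : c != col y by rewrite eq_sym -cz ncU.
    have := color_step colP hz ht hzt cz ct cy.
    by rewrite (negPf (ncU _ hzt ztU)) => /eqP.
  apply/and4P; split=> //; first by rewrite czt.
  rewrite -sz; apply/eqP; apply: (same_color_sign colP) => //; first by rewrite czt.
  by rewrite ct cz eq_sym ncU.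
have := @string_closed _ _ Psi sysPsi Y y s.
case/(_ _ _ _ _ _ _)/and4P => //.
- by move=> z /and4P[].
- by apply/negP => /and4P[_ _]; rewrite cs eq_sym (negPf (ncU _ hy yU)).
- by apply/negP => /and4P[_ _]; rewrite cNs eq_sym (negPf (ncU _ hy yU)).
- by move=> z hz; split=> h; apply: step.
- by apply/and4P; split.
by move=> ? ? /eqP ? /eqP ?; split.
Qed.

(** The term of [1] is positive. The others pair [p i] with roots that, by [orbit_color], share the
    colour and the [p0]-sign of [x], hence its sign for [p i]. *)
Lemma avg_pos i x : x \in Psi -> x \notin U -> 0 < dotp (p i) x ->
  0 < dotp (avg (p i)) x.
Proof.
move=> hx xU pos; have [_ _ hc] := colP.
rewrite /avg dotp_suml (bigD1 1%g) ?group1 //= ltr_pwDl //; first by rewrite rG_1.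
rewrite sumr_ge0 // => g /andP[hg _]; rewrite dotp_rG ltW //.
have [h1 _ h2 h3] := orbit_color (groupVr hg) hx xU.
by rewrite hc // h2 h3 -hc.
Qed.

Lemma avg_coloring : exists mu : 'I_3 -> 'cV[F]_n,
  (forall i x, x \in U -> dotp (mu i) x = 0) /\
  {in Psi, forall x, x \notin U -> forall i, 0 < dotp (p i) x -> 0 < dotp (mu i) x}.
Proof. by exists (fun i => avg (p i)); split=> [i x /avg_orth->|x ? ? i ?]; rewrite ?avg_pos. Qed.

End Average.

(** With [U] the span of a colour [c] that does not span, vectors [nu] of sum zero, orthogonal to
    [U] and with the right signs outside [U], are corrected by a small multiple of the vectors
    obtained by induction for the roots in [U]. *)
Lemma balanced_vectors Psi p0 p col : uniq Psi -> root_subsystem Psi ->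
    sign_coloring Psi p0 p col ->
    {in Psi, forall s, exists g, rG g = reflection_mx s} ->
  exists la : 'I_3 -> 'cV[F]_n, \sum_i la i = 0 /\
    {in Psi, forall x i, 0 < dotp (p i) x -> 0 < dotp (la i) x}.
Proof.
have [k] := ubnP (size Psi); elim: k => // k IH in Psi *; rewrite ltnS => szP.
move=> uP sysP colP reflP; case: (eqVneq Psi [::]) => [->|nP].
  by exists (fun=> 0); split=> //; rewrite big1.
have [c nsp] := not_all_spanning sysP colP uP nP.
pose U := <<[seq s <- Psi | col s == c]>>%VS.
have [x0 hx0 x0U] : exists2 x, x \in Psi & x \notin U.
  apply: contrapT => h; apply: nsp => q hq x hx; apply: (@dotp_span0 _ _ [seq s <- Psi | col s == c]).
    by move=> s; rewrite mem_filter => /andP[/eqP cs hs]; apply: hq.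
  by apply/negPn/negP => xU; apply: h; exists x.
pose Psi' := [seq x <- Psi | x \in U].
have sub : {subset Psi' <= Psi} by move=> x; rewrite mem_filter => /andP[].
have [|||||ka [ka0 kap]] := IH Psi'.
- apply: leq_trans szP; rewrite size_filter -(count_predC (mem U)) -[X in (X < _)%N]addn0.
  by rewrite ltn_add2l -has_count; apply/hasP; exists x0.
- exact: filter_uniq.
- have [h0 hN hr hi hP] := sysP; split.
  + by apply: contra h0 => /sub.
  + by move=> x; rewrite !mem_filter => /andP[xU /hN ->]; rewrite rpredN xU.
  + move=> x y; rewrite !mem_filter => /andP[xU hx] /andP[yU hy].
    by rewrite hr // andbT reflectionE rpredB // rpredZ.
  + by move=> x y /sub hx /sub hy; apply: hi.
  move=> x y; rewrite !mem_filter => /andP[xU hx] /andP[yU hy] neg n0.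
  by rewrite rpredD // hP.
- have [h1 h2 h3] := colP; split=> x /sub; [exact: h1|exact: h2|exact: h3].
- by move=> x /sub; apply: reflP.
have [mu [muU mup]] := avg_coloring c sysP colP reflP.
case: (third_color (_ : c != if c == ord0 then ord_max else ord0)) => [|b [bc _ _]].
  by case: (eqVneq c ord0) => [->|].
have [a [ab ac abc]] := third_color bc.
have cb := negPf bc; have cab := negPf ab; have cac := negPf ac.
(* Outside [U] only the colours [a] and [b] occur, so [p a] and [p b] have opposite signs there and
   [- mu b] can serve for [a]. *)
have neg_b x i : i != b -> i != c -> x \in Psi -> x \notin U ->
    0 < dotp (p i) x -> 0 < dotp (- mu b) x.
  move=> ib ic hx xU pos; rewrite dotpNl -dotpNr; apply: mup.
  - by rewrite (mem_rootN sysP).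
  - by rewrite rpredN.
  have [h1 h2 h3] := colP; rewrite h3 ?(mem_rootN sysP) // (colN sysP colP) // (sgN colP) //.
  have cx : col x != c.
    apply: contra xU => /eqP cx; apply: memv_span.
    by rewrite mem_filter cx eqxx.
  move: pos; rewrite h3 //; have := abc (col x); have := abc i.
  rewrite (negPf cx) (negPf ib) (negPf ic) !orbF => /eqP ->.
  by case/orP=> /eqP ->; rewrite !eqxx ?[b == a]eq_sym cab; case: (0 < _).
have [e e0 he] := small_perturbation_fin Psi
  (fun _ : 'I_1 => dotp (- mu b)) (fun _ => dotp (- mu c)).
(* The sum is zero by the choice of [nu a], and [e] is so small that [nu a] keeps the signs of
   [- mu b]. *)
pose nu i := if i == b then mu b else if i == c then e *: mu c else - mu b - e *: mu c.
have nu0 : \sum_i nu i = 0.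
  rewrite (bigD1 b) //= (bigD1 c) /=; last by rewrite eq_sym bc.
  rewrite (bigD1 a) /=; last by rewrite ab ac.
  rewrite big1 => [|i /andP[/andP[ib ic] ia]]; last first.
    by have := abc i; rewrite (negPf ia) (negPf ib) (negPf ic).
  rewrite /nu eqxx eq_sym cb eqxx cab cac addr0 [e *: _ + _]addrC addrNK.
  exact: subrr.
have nuU i x : x \in U -> dotp (nu i) x = 0.
  by move=> xU; rewrite /nu; do 2?case: ifP => _;
    rewrite ?dotpDl ?dotpNl ?dotpZl ?muU // ?mulr0 ?oppr0 ?addr0.
have nup x i : x \in Psi -> x \notin U -> 0 < dotp (p i) x -> 0 < dotp (nu i) x.
  move=> hx xU pos; rewrite /nu; case: eqP => [ib|/eqP ib].
    by rewrite -ib; apply: mup.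
  case: eqP => [ic|/eqP ic]; first by rewrite dotpZl mulr_gt0 // -ic; apply: mup.
  rewrite -scalerN dotpDl dotpZl; apply: he => //; first exact: ord0.
  exact: (neg_b _ i).
have [d d0 hd] := small_perturbation_fin Psi (fun i => dotp (nu i)) (fun i => dotp (ka i)).
exists (fun i => nu i + d *: ka i); split.
  by rewrite big_split /= nu0 -scaler_sumr ka0 scaler0 addr0.
move=> x hx i pos; rewrite dotpDl dotpZl; case xU : (x \in U).
  by rewrite nuU // add0r mulr_gt0 // kap // mem_filter xU.
by apply: hd => //; apply: nup; rewrite ?xU.
Qed.

End Balanced.

(** * Independence *)

Section FreeFamilies.
Variables (F : realType) (n : nat).
Implicit Types (x y d e q : 'cV[F]_n) (t : seq 'cV[F]_n).

Lemma dual_vector t d : free t -> d \in t ->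
  exists q, {in t, forall e, dotp q e = (e == d)%:R}.
Proof.
move=> ft hd; have hk : (index d t < size t)%N by rewrite index_mem.
pose f x := coord (in_tuple t) (Ordinal hk) x.
exists (\col_i f (delta_mx i 0)) => e he.
have -> : dotp (\col_i f (delta_mx i 0)) e = f e.
  rewrite dotpE {2}[e]matrix_sum_delta; under eq_bigr => i _ do rewrite mxE.
  rewrite /f linear_sum; apply: eq_bigr => i _.
  by rewrite zmodp.big_ord1 linearZ /= mulrC.
have hi : (index e t < size t)%N by rewrite index_mem.
have -> : f e = f (in_tuple t)`_(Ordinal hi) by rewrite /= nth_index.
rewrite /f coord_free //; congr ((nat_of_bool _)%:R); rewrite -val_eqE /=.
by apply/eqP/eqP => [h|->//]; rewrite -(nth_index 0 he) h nth_index.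
Qed.

Lemma dotp_dual_sum t d q (c : 'cV[F]_n -> F) : uniq t -> d \in t ->
    {in t, forall e, dotp q e = (e == d)%:R} ->
  dotp q (\sum_(e <- t) c e *: e) = c d.
Proof.
move=> ut hd hq; rewrite dotp_sumr (big_rem d) //= dotpZr hq // eqxx mulr1.
rewrite big_seq big1 ?addr0 // => e; rewrite mem_rem_uniq // inE => /andP[ne he].
by rewrite dotpZr hq // (negPf ne) mulr0.
Qed.

(** For [u] of maximal weight, [q u] is orthogonal to all other [x v] but not to [x u], so [x u] is
    outside their span. *)
Lemma triangular_free (T : eqType) (s : seq T) (x q : T -> 'cV[F]_n) (wt : T -> F) :
    uniq s -> {in s, forall u, dotp (q u) (x u) != 0} ->
    {in s &, forall u v, dotp (q u) (x v) != 0 -> v = u \/ wt u < wt v} ->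
  free [seq x u | u <- s].
Proof.
have [k] := ubnP (size s); elim: k => // k IH in s *; rewrite ltnS => ks us h1 h2.
case: s => [|u0 s0] in ks us h1 h2 *; first by rewrite nil_free.
have := mem_head u0 s0; move: (u0 :: s0) ks us h1 h2 => {}s ks us h1 h2 hu0.
have [u hu mu] := seq_argmax wt hu0.
rewrite (perm_free (perm_map x (perm_to_rem hu))) /= free_cons.
have sub : {subset rem u s <= s} by apply: mem_rem.
apply/andP; split; last first.
  apply: IH; rewrite ?rem_uniq //.
  - by rewrite size_rem // prednK //; case: (s) hu.
  - by move=> v /sub; apply: h1.
  by move=> v v' /sub hv /sub; apply: h2.
apply: contra (h1 u hu) => /dotp_span0 -> // _ /mapP[v hv ->].
apply/eqP/negPn/negP => nz; have hvs := sub _ hv.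
case: (h2 u v hu hvs nz) => [e|lt]; last by have := mu _ hvs; rewrite leNgt lt.
by move: hv; rewrite mem_rem_uniq // e inE eqxx.
Qed.

Lemma free_size t : free t -> (size t <= n)%N.
Proof.
move/eqP <-; apply: leq_trans (dimvS (subvf _)) _.
by rewrite dimvf /dim /= muln1.
Qed.

End FreeFamilies.

(* If [d] is an element of the basis of [p i] which is negative for [p0], then
   [- d] is positive for the two other [p j]; as its coordinates there are
   integers, [la i d] exceeds [la j e] for each [e] in the support of [d]. *)
Lemma balanced_bound (F : realType) (n : nat) (Psi : seq 'cV[F]_n) p0 p col
    (la : 'I_3 -> 'cV[F]_n) (t : 'I_3 -> seq 'cV[F]_n) :
    root_subsystem Psi -> sign_coloring Psi p0 p col ->
    \sum_i la i = 0 ->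
    {in Psi, forall x i, 0 < dotp (p i) x -> 0 < dotp (la i) x} ->
    (forall i, free (t i)) -> (forall i, {subset t i <= Psi}) ->
    (forall i, {in t i, forall d, 0 < dotp (p i) d}) ->
    {in Psi, forall x i, 0 < dotp (p i) x -> nonneg_comb (t i) x} ->
  (\sum_i count (fun d => dotp p0 d < 0)%R (t i) <= n)%N.
Proof.
move=> sysP colP la0 lap ft tP tpos tcomb.
pose s := [seq (i, d) | i <- enum 'I_3, d <- [seq d <- t i | dotp p0 d < 0]].
have -> : (\sum_i count (fun d => dotp p0 d < 0)%R (t i))%N = size s.
  rewrite size_allpairs_dep sumnE big_map big_enum.
  by apply: eq_bigr => i _; rewrite size_filter.
have sP u : u \in s -> u.2 \in t u.1 /\ dotp p0 u.2 < 0.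
  by case/allpairsPdep=> i [d [_ + ->]]; rewrite mem_filter => /andP[].
have us : uniq s.
  apply: allpairs_uniq_dep; first exact: enum_uniq.
    by move=> i _; rewrite filter_uniq // free_uniq.
  by move=> [i d] [j e] _ _ [-> ->].
have /choice[q hq] (u : 'I_3 * 'cV[F]_n) :
    exists q, u \in s -> {in t u.1, forall e, dotp q e = (e == u.2)%:R}.
  case: (boolP (u \in s)) => [/sP[hu _]|_]; last by exists 0.
  by have [q hq] := dual_vector (ft u.1) hu; exists q.
rewrite -(size_map snd); apply: free_size.
apply: (triangular_free (q := q) (wt := fun u => dotp (la u.1) u.2)) => //.
  by move=> u hu; have [hu' _] := sP _ hu; rewrite hq // eqxx oner_eq0.
move=> [j e] [i d] hu hv /=; have [/= he _] := sP _ hu; have [/= hd dneg] := sP _ hv.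
case: (eqVneq i j) => [eij|ij] nz; [left|right].
  move: nz; rewrite eij in hd *; rewrite (hq _ hu) //=.
  by case: (eqVneq d e) => [->|]; rewrite ?eqxx.
have hdP : d \in Psi by apply: tP hd.
have hNd : - d \in Psi by rewrite (mem_rootN sysP).
have [h1 h2 hc] := colP.
have sd : (0 < dotp p0 d) = false by rewrite ltNge ltW.
have cd : col d = i.
  by have := tpos i _ hd; rewrite hc // sd; case: eqP.
have pNd k : k != i -> 0 < dotp (p k) (- d).
  move=> ki; rewrite hc // (sgN colP) // sd (colN sysP colP) // cd.
  by rewrite (negPf ki).
have [k [ki kj kij]] := third_color ij.
(* The three vectors sum to zero. The first term is at least [dotp (la j) e], and the second is
   positive, which makes the comparison of weights strict. *)
have ed : dotp (la i) d = dotp (la j) (- d) + dotp (la k) (- d).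
  have := congr1 (fun z => dotp z d) la0; rewrite dotp0l dotp_suml.
  rewrite (bigD1 i) //= (bigD1 j) /=; last by rewrite eq_sym.
  rewrite (bigD1 k) /=; last by rewrite ki kj.
  rewrite big1 => [|l /andP[/andP[li lj] lk]]; last first.
    by have := kij l; rewrite (negPf li) (negPf lj) (negPf lk).
  by rewrite !dotpNr; lra.
have jpos : 0 < dotp (p j) (- d) by apply: pNd; rewrite eq_sym.
have [c ec] := tcomb _ hNd j jpos.
have uj : uniq (t j) by apply: free_uniq.
have ce : (0 < c e)%N.
  rewrite lt0n; apply: contraNneq nz => c0; rewrite -oppr_eq0 -dotpNr ec.
  by rewrite (dotp_dual_sum (fun a => (c a)%:R) uj he (hq _ hu)) c0.
have lapos a : a \in t j -> 0 < dotp (la j) a.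
  by move=> ha; apply: lap; [apply: tP ha|apply: tpos].
have le_e : dotp (la j) e <= dotp (la j) (- d).
  rewrite ec dotp_sumr (big_rem e) //= dotpZr.
  rewrite -[X in X <= _]mul1r -[X in X <= _]addr0 lerD //.
    by rewrite ler_pM2r ?lapos // ler1n.
  rewrite big_seq sumr_ge0 // => a ha; rewrite dotpZr mulr_ge0 ?ler0n //.
  by rewrite ltW // lapos // (mem_rem ha).
by rewrite ed; apply: le_lt_trans le_e _; rewrite ltrDl; apply/lap/pNd.
Qed.

(** * Lengths, weak order and walls *)

Lemma eq_sum_nat (T : eqType) (s : seq T) (f g : T -> nat) :
    {in s, forall x, (f x <= g x)%N} ->
  ((\sum_(x <- s) f x)%N == (\sum_(x <- s) g x)%N) = all (fun x => f x == g x) s.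
Proof.
elim: s => [|x s IH] h; first by rewrite !big_nil.
rewrite !big_cons /= -IH => [|y hy]; last by apply: h; rewrite in_cons hy orbT.
have h1 := h x (mem_head _ _).
have h2 : (\sum_(y <- s) f y <= \sum_(y <- s) g y)%N.
  by rewrite big_seq [leqRHS]big_seq leq_sum // => y hy; apply: h; rewrite in_cons hy orbT.
by apply/eqP/andP => [e|[/eqP-> /eqP->]] //; split; apply/eqP; lia.
Qed.

(** For the closure under sums: if the integer [2 (a, b) / (a, a)] is [-1], the reflection of [b] is
    [b + a]; otherwise a negative one is at most [-2]. The latter in both orders gives
    [(x + y, x + y) <= 0]. *)
Lemma crystallographic_subsystem (R : realType) (n : nat) (Phi : seq 'cV[R]_n) :
  crystallographic_root_system Phi -> root_subsystem (undup Phi).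
Proof.
move=> [h0 _ h1 hr hi].
have hN x : x \in Phi -> - x \in Phi.
  by move=> hx; have := h1 x hx (-1); rewrite scaleN1r => ->; right.
have n0 x : x \in Phi -> 0 < dotp x x.
  by move=> hx; rewrite dotp_gt0; apply: contraNneq h0 => <-.
split; rewrite ?mem_undup //.
- by move=> x; rewrite !mem_undup; apply: hN.
- by move=> x y; rewrite !mem_undup; apply: hr.
- by move=> x y; rewrite !mem_undup; apply: hi.
move=> x y; rewrite !mem_undup => hx hy neg xy.
have half a b : a \in Phi -> b \in Phi -> dotp a b < 0 ->
    b + a \in Phi \/ dotp a b <= - dotp a a.
  move=> ha hb ab; have := hi _ _ ha hb; have := hr _ _ ha hb; rewrite reflectionE.
  have aa := n0 a ha; move=> hab /intrP[m em]; rewrite em in hab.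
  have e2 : 2 * dotp a b = m%:~R * dotp a a by rewrite -em mulfVK // gt_eqF.
  have m0 : (m < 0)%R.
    by rewrite -(ltrz0 R) -em pmulr_llt0 ?invr_gt0 // pmulr_rlt0.
  case: (eqVneq m (-1)) => [e|ne].
    by left; move: hab; rewrite e mulrN1z scaleN1r opprK.
  right; have m2 : (m <= -2)%R by lia.
  have : m%:~R <= (-2)%:~R :> R by rewrite ler_int.
  rewrite -(ler_pM2r aa) -e2 => h; rewrite -(ler_pM2l (ltr0n R 2)) mulrN.
  by apply: le_trans h _; rewrite mulrNz mulNr.
case: (half x y hx hy neg) => [|h]; first by rewrite addrC.
case: (half y x hy hx) => [||h']; [by rewrite dotpC|by []|].
move: xy; rewrite -dotp_gt0 !dotp_lin (dotpC y x) in h' *.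
by lra.
Qed.

(** * Chambers and signs of roots *)

Section WeylGroup.
Variables (R : realType) (W : finGroupType) (n : nat).
Variables (Phi Delta : seq 'cV[R]_n) (rG : mx_representation R [set: W] n).
Hypotheses (crystPhi : crystallographic_root_system Phi).
Hypotheses (simpleDelta : simple_roots Phi Delta) (faithG : mx_faithful rG).
Hypothesis reflG : {in Phi, forall a, exists x, rG x = reflection_mx a}.
Hypothesis genG :
  <<[set x | rG x \in [seq reflection_mx a | a <- Phi]]>>%g = [set: W].
Implicit Types (x y d e : 'cV[R]_n) (g h u v w z : W).

Local Notation Psi := (undup Phi).

Let sysPsi : root_subsystem Psi := crystallographic_subsystem crystPhi.
Let subDelta : {subset Delta <= Psi}.
Proof. by case: simpleDelta => h _ _ d /h; rewrite mem_undup. Qed.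
Let freeDelta : free Delta.
Proof. by case: simpleDelta => _ /andP[]. Qed.

Lemma size_simple_roots : size Delta = n.
Proof.
case: simpleDelta => _ /andP[/eqP e fr] _; move/eqP: fr; rewrite e => <-.
by rewrite dimvf /dim /= muln1.
Qed.

Lemma generation_ind (P : W -> Prop) : P 1%g ->
    (forall a g h, a \in Psi -> rG g = reflection_mx a -> P h -> P (g * h)%g) ->
  forall g, P g.
Proof.
move=> P1 PM g; have : g \in [set: W] by rewrite inE.
rewrite -genG => /gen_prodgP[k [f hf ->]]; elim: k f hf => [|k IH] f hf.
  by rewrite big_ord0.
rewrite big_ord_recl; have := hf ord0; rewrite inE => /mapP[a ha e].
by apply: (PM a) => //; [rewrite mem_undup|apply: IH].
Qed.

Lemma orthG g x y : dotp (rG g *m x) (rG g *m y) = dotp x y.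
Proof.
elim/generation_ind: g x y => [|a g h ha hg IH] x y; first by rewrite !rG_1.
rewrite !rG_M -[RHS]IH hg !reflectionE !dotp_lin.
rewrite (dotpC (rG h *m x) a); have : dotp a a != 0.
  by rewrite dotp_eq0 (root_neq0 sysPsi ha).
by move=> aa; field.
Qed.

Lemma mem_rG g x : (rG g *m x \in Psi) = (x \in Psi).
Proof.
have h k y : y \in Psi -> rG k *m y \in Psi.
  elim/generation_ind: k y => [|a k k' ha hk IH] y hy; first by rewrite rG_1.
  by rewrite rG_M hk; case: sysPsi => _ _ hr _ _; apply: hr => //; apply: IH.
apply/idP/idP => [|/h //]; move/(h g^-1%g).
by rewrite -rG_M mulVg rG_1.
Qed.

Lemma rGN g x : rG g *m (- x) = - (rG g *m x).
Proof. exact: mulmxN. Qed.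

Lemma rG_inj_act g h : (forall x, rG g *m x = rG h *m x) -> g = h.
Proof.
move=> e; apply: (mx_faithful_inj faithG); rewrite ?inE //.
apply/matrixP => i j; have := congr1 (fun M : 'cV[R]_n => M i 0) (e (delta_mx j 0)).
by rewrite /= -!colE !mxE.
Qed.

Lemma rG_inj_vec d e g : (rG g *m d == rG g *m e) = (d == e).
Proof.
apply/eqP/eqP => [|-> //]; move/(congr1 (mulmx (rG g^-1%g))).
by rewrite -!rG_M mulVg !rG_1.
Qed.

(** The sum of the dual basis is a point of the open fundamental chamber; its images under [W]
    represent the chambers. *)
Lemma height_vector : exists q0, {in Delta, forall d, dotp q0 d = 1}.
Proof.
have /choice[q hq] d : exists q, d \in Delta ->
    {in Delta, forall e, dotp q e = (e == d)%:R}.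
  case: (boolP (d \in Delta)) => [hd|_]; last by exists 0.
  by have [q hq] := dual_vector freeDelta hd; exists q.
exists (\sum_(d <- Delta) q d) => e he.
rewrite dotp_suml (big_rem e) //= hq // eqxx big_seq big1 ?addr0 // => d.
rewrite mem_rem_uniq ?free_uniq // inE => /andP[de hd].
by rewrite hq // eq_sym (negPf de).
Qed.

Variables (q0 : 'cV[R]_n) (q0P : {in Delta, forall d, dotp q0 d = 1}).

(* The sign of the root [x] on the chamber of [g]. *)
Definition sgn g x : bool := 0 < dotp (rG g *m q0) x.

Lemma sgnE g x : sgn g x = sgn 1 (rG g^-1%g *m x).
Proof. by rewrite /sgn (dotp_rG orthG) rG_1. Qed.

Lemma sgn_act g h x : sgn g (rG h *m x) = sgn (h^-1 * g) x.
Proof. by rewrite sgnE [RHS]sgnE invMg invgK rG_M. Qed.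

Lemma nonneg_comb_pos x : x \in Psi -> nonneg_comb Delta x -> 0 < dotp q0 x.
Proof.
move=> hx [c ex]; have e : dotp q0 x = \sum_(a <- Delta) (c a)%:R.
  rewrite ex dotp_sumr; apply: eq_big_seq => a ha; by rewrite dotpZr q0P // mulr1.
rewrite e lt0r sumr_ge0 // andbT; apply: contra (root_neq0 sysPsi hx).
rewrite psumr_eq0 // => /allP h; rewrite ex big_seq big1 // => a /h /= /eqP ->.
by rewrite scale0r.
Qed.

Lemma sgn1_comb x : x \in Psi -> sgn 1 x -> nonneg_comb Delta x.
Proof.
move=> hx; rewrite /sgn rG_1 => pos; case: simpleDelta => _ _ h.
have [//|hN] := h x (etrans (esym (mem_undup _ _)) hx).
have := nonneg_comb_pos (etrans (mem_rootN sysPsi x) hx) hN.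
by rewrite dotpNr oppr_gt0 => /(lt_trans pos); rewrite ltxx.
Qed.

Lemma chamber_neq0 g x : x \in Psi -> dotp (rG g *m q0) x != 0.
Proof.
move=> hx; rewrite (dotp_rG orthG); have := mem_rG g^-1%g x; rewrite hx.
move: (rG _ *m x) => y hy; case: simpleDelta => _ _ h.
case: (h y (etrans (esym (mem_undup _ _)) hy)) => [/(nonneg_comb_pos hy)|].
  by move/gt_eqF->.
move/(nonneg_comb_pos (etrans (mem_rootN sysPsi y) hy)).
by rewrite dotpNr oppr_gt0 => /lt_eqF->.
Qed.

Lemma sgn_opp g x : x \in Psi -> sgn g (- x) = ~~ sgn g x.
Proof.
move=> hx; rewrite /sgn dotpNr oppr_gt0 -leNgt le_eqVlt.
by rewrite (negPf (chamber_neq0 g hx)).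
Qed.

Lemma sgn1_simple d : d \in Delta -> sgn 1 d.
Proof. by move=> hd; rewrite /sgn rG_1 q0P. Qed.

Lemma sgn_self g d : d \in Delta -> sgn g (rG g *m d).
Proof. by move=> hd; rewrite sgn_act mulVg sgn1_simple. Qed.

Definition root_refl d : W := odflt 1%g [pick g | rG g == reflection_mx d].

Lemma root_reflE d : d \in Psi -> rG (root_refl d) = reflection_mx d.
Proof.
rewrite mem_undup => /reflG[g hg]; rewrite /root_refl.
by case: pickP => [h /eqP //|/(_ g)]; rewrite hg eqxx.
Qed.

Lemma root_refl_unique d g : d \in Psi -> rG g = reflection_mx d -> g = root_refl d.
Proof.
by move=> hd hg; apply: (mx_faithful_inj faithG); rewrite ?inE // root_reflE.
Qed.

Lemma root_reflK d : d \in Psi -> (root_refl d * root_refl d = 1)%g.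
Proof.
move=> hd; apply: rG_inj_act => x.
by rewrite rG_M rG_1 !root_reflE // reflectionK // (root_neq0 sysPsi).
Qed.

Lemma root_reflV d : d \in Psi -> ((root_refl d)^-1 = root_refl d)%g.
Proof. by move=> hd; apply/eqP; rewrite eq_invg_mul root_reflK. Qed.

Lemma refl_self d : d \in Psi -> reflection_mx d *m d = - d.
Proof.
move=> hd; rewrite reflectionE mulfK ?dotp_eq0 ?(root_neq0 sysPsi) //.
by rewrite scaler_nat mulr2n opprD addrA subrr add0r.
Qed.

Lemma root_refl_conj g d e : d \in Psi -> e \in Psi -> rG g *m d = e ->
  (g * root_refl d = root_refl e * g)%g.
Proof.
move=> hd he ge; apply: rG_inj_act => x.
rewrite !rG_M !root_reflE // !reflectionE mulmxBr -scalemxAr ge.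
by congr (_ - _ *: _); rewrite -ge !orthG.
Qed.

(** The reflection changes only the coordinate at [d]. If it made a positive [x] negative, all other
    coordinates would vanish, and [x] would be a multiple of [d]. *)
Lemma sgn1_refl_simple d x : d \in Delta -> x \in Psi -> x != d -> x != - d ->
  sgn 1 (reflection_mx d *m x) = sgn 1 x.
Proof.
move=> hd; have hdP := subDelta hd; wlog sx : x / sgn 1 x.
  move=> h hx xd xNd; case sx : (sgn 1 x); first by rewrite h.
  have := h (- x); rewrite sgn_opp // sx (mem_rootN sysPsi) hx eqr_oppLR xNd.
  rewrite eqr_opp xd mulmxN sgn_opp => [|]; last first.
    by case: sysPsi => _ _ hr _ _; apply: hr.
  by move=> /(_ isT isT isT isT); case: sgn.
move=> hx xd xNd; have hr : reflection_mx d *m x \in Psi.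
  by case: sysPsi => _ _ hr _ _; apply: hr.
rewrite sx; apply/negPn/negP => sr.
have [c ex] := sgn1_comb hx sx.
have [||c' ex'] := @sgn1_comb (- (reflection_mx d *m x)).
- by rewrite (mem_rootN sysPsi).
- by rewrite sgn_opp.
have uD := free_uniq freeDelta.
have c0 e : e \in Delta -> e != d -> c e = 0%N.
  move=> he ne; have [q hq] := dual_vector freeDelta he.
  have e1 : dotp q x = (c e)%:R by rewrite ex (dotp_dual_sum (fun a => (c a)%:R) uD he hq).
  have e2 : dotp q (- (reflection_mx d *m x)) = (c' e)%:R.
    by rewrite ex' (dotp_dual_sum (fun a => (c' a)%:R) uD he hq).
  move: e2; rewrite reflectionE !dotp_lin (hq d hd) eq_sym (negPf ne) mulr0 subr0 e1.
  move=> h; apply/eqP; rewrite -(eqr_nat R); have := ler0n R (c e); have := ler0n R (c' e).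
  by rewrite -h; lra.
have exd : x = (c d)%:R *: d.
  rewrite {1}ex (big_rem d) //= big_seq big1 ?addr0 // => e.
  by rewrite mem_rem_uniq // inE => /andP[ne he]; rewrite c0 // scale0r.
case: crystPhi => _ _ hc _ _; have := hc d _ (c d)%:R.
rewrite -exd -!(mem_undup Phi) => /(_ hdP)[/(_ hx)[] e _].
  by move: xd; rewrite exd e scale1r eqxx.
by move: xNd; rewrite exd e scaleN1r eqxx.
Qed.

Lemma sgn_mul_simple g d x : d \in Delta -> x \in Psi ->
  sgn (g * root_refl d) x =
    sgn g x (+) ((x == rG g *m d) || (x == - (rG g *m d))).
Proof.
move=> hd hx; have hdP := subDelta hd.
rewrite sgnE invMg rG_M root_reflV // root_reflE // [sgn g x]sgnE.
have <- : (rG g^-1%g *m x == d) = (x == rG g *m d).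
  by rewrite -(rG_inj_vec _ d g) -rG_M mulgV rG_1.
have <- : (rG g^-1%g *m x == - d) = (x == - (rG g *m d)).
  by rewrite -(rG_inj_vec _ (- d) g) -rG_M mulgV rG_1 rGN.
have : rG g^-1%g *m x \in Psi by rewrite mem_rG.
move: (rG _ *m x) => y hy.
case: (eqVneq y d) => [->|yd] /=; first by rewrite refl_self // sgn_opp // addbT.
case: (eqVneq y (- d)) => [->|yNd] /=; last by rewrite addbF sgn1_refl_simple.
by rewrite mulmxN refl_self // opprK sgn_opp // addbT negbK.
Qed.

(** * Coxeter length and weak order in terms of signs *)

Variable S : {set W}.
Hypothesis defS : S = [set x | rG x \in [seq reflection_mx a | a <- Delta]].
Hypothesis genS : <<S>>%g = [set: W].

Lemma simple_reflP s : reflect (exists2 d, d \in Delta & s = root_refl d) (s \in S).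
Proof.
rewrite defS inE; apply: (iffP mapP) => [[d hd e]|[d hd ->]]; exists d => //.
  by apply: root_refl_unique; rewrite ?subDelta.
by rewrite root_reflE ?subDelta.
Qed.

Lemma root_refl_inj : {in Delta &, injective root_refl}.
Proof.
move=> d e hd he h; apply/eqP; apply: contraT => ne.
have dP := subDelta hd; have eP := subDelta he.
have dNe : d != - e.
  by apply: contraTneq (sgn1_simple hd) => ->; rewrite sgn_opp // sgn1_simple.
have := sgn1_refl_simple he dP ne dNe.
by rewrite -root_reflE // -h root_reflE // refl_self // sgn_opp // sgn1_simple.
Qed.

(** Each wall is counted twice, for a root and its opposite; hence the doublings below. *)
Definition separation g h : nat := \sum_(x <- Psi) (sgn g x (+) sgn h x).

Lemma separation_simple g d : d \in Delta -> sgn 1 (rG g *m d) ->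
  separation 1 (g * root_refl d) = (separation 1 g).+2.
Proof.
move=> hd sd; set b := rG g *m d in sd.
have hb : b \in Psi by rewrite mem_rG subDelta.
have hNb : - b \in Psi by rewrite (mem_rootN sysPsi).
have bNb : b != - b by apply/eqP => e; have := sgn_opp 1 hb; rewrite -e sd.
have one y : y \in Psi -> (\sum_(x <- Psi) (x == y) = 1)%N.
  move=> hy; rewrite (big_rem y) //= eqxx big_seq big1 // => x.
  by rewrite mem_rem_uniq ?undup_uniq // inE => /andP[/negPf->].
transitivity (\sum_(x <- Psi) ((sgn 1 x (+) sgn g x) + (x == b) + (x == - b)))%N; last first.
  by rewrite !big_split /= !one // !addn1.
apply: eq_big_seq => x hx; rewrite sgn_mul_simple //= -/b.
case: (eqVneq x b) => [->|xb]; first by rewrite (negPf bNb) sd sgn_self.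
case: (eqVneq x (- b)) => [->|xNb]; first by rewrite !sgn_opp // sd sgn_self.
by rewrite addbF !addn0.
Qed.

Lemma separation_simpleN g d : d \in Delta -> ~~ sgn 1 (rG g *m d) ->
  separation 1 g = (separation 1 (g * root_refl d)).+2.
Proof.
move=> hd sd; have hdP := subDelta hd.
rewrite -(@separation_simple _ d) // -?mulgA ?root_reflK ?mulg1 //.
by rewrite rG_M root_reflE // refl_self // rGN sgn_opp ?mem_rG ?negbK.
Qed.

(** The exchange condition. Let [g] be the reflection in a simple root [e] times [h]. If [rG h *m d]
    is positive, the first letter makes it negative, so it is [e] and [g * root_refl d = h];
    otherwise induction deletes a letter of [h]. *)
Lemma exchange k g d : g \in (S ^+ k)%g -> d \in Delta -> ~~ sgn 1 (rG g *m d) ->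
  (0 < k)%N /\ (g * root_refl d)%g \in (S ^+ k.-1)%g.
Proof.
elim: k g => [|k IH] g.
  by rewrite expg0 inE => /eqP-> hd; rewrite rG_1 sgn1_simple.
rewrite expgS => /mulsgP[s h /simple_reflP[e he ->] hh ->] hd.
have hdP := subDelta hd; have heP := subDelta he.
have hP : rG h *m d \in Psi by rewrite mem_rG.
rewrite rG_M root_reflE // => neg; split=> //=; case sh : (sgn 1 (rG h *m d)).
  have ed : rG h *m d = e.
    apply/eqP; apply: contraNT neg => ne; rewrite sgn1_refl_simple //.
    by apply: contraTneq sh => ->; rewrite sgn_opp // sgn1_simple.
  by rewrite -mulgA (root_refl_conj hdP heP ed) mulgA root_reflK // mul1g.
have [k0 hk] := IH h hh hd (negbT sh).
rewrite -(prednK k0) expgS -mulgA mem_mulg //; apply/simple_reflP; by exists e.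
Qed.

Lemma word_length k g : g \in (S ^+ k)%g -> (separation 1 g <= k.*2)%N.
Proof.
elim: k g => [|k IH] g.
  rewrite expg0 inE => /eqP->; rewrite /separation big1 // => x _.
  by rewrite addbb.
rewrite expgSr => /mulsgP[h s hh /simple_reflP[d hd ->] ->].
have := IH h hh; case sh : (sgn 1 (rG h *m d)).
  by rewrite separation_simple // doubleS !ltnS.
rewrite (separation_simpleN hd (negbT sh)) doubleS => le.
by apply/leqW/leqW/ltnW/ltnW.
Qed.

(** Letters are appended one by one; when one of them lowers the separation from [1], [exchange]
    yields a shorter word. *)
Lemma reduced_word g : exists2 k, g \in (S ^+ k)%g & separation 1 g = k.*2.
Proof.
have : g \in <<S>>%g by rewrite genS inE.
move=> /gen_prodgP[m [f hf ->]]; elim: m f hf => [|m IH] f hf.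
  exists 0%N; first by rewrite big_ord0 expg0 inE.
  rewrite big_ord0 /separation big1 // => x _; by rewrite addbb.
rewrite big_ord_recr /=; have [|k hk ek] := IH (fun i => f (widen_ord (leqnSn m) i)).
  by [].
set h := (X in (X * _)%g); rewrite -/h in hk ek.
have /simple_reflP[d hd ->] := hf ord_max.
case sh : (sgn 1 (rG h *m d)).
  exists k.+1; last by rewrite separation_simple // ek.
  by rewrite expgSr mem_mulg //; apply/simple_reflP; exists d.
have [k0 hk'] := exchange hk hd (negbT sh).
exists k.-1 => //; have := separation_simpleN hd (negbT sh).
by rewrite ek -{1}(prednK k0) doubleS => -[].
Qed.

Lemma cox_lengthE g : (cox_length S g).*2 = separation 1 g.
Proof.
rewrite /cox_length; case: ex_minnP => m hm min.
have [k hk ek] := reduced_word g; rewrite ek; congr double; apply/eqP.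
rewrite eqn_leq min ?hk //= -leq_double -ek.
by move: hm; rewrite genS inE orbF => /word_length.
Qed.

Lemma separation_mull g h z : separation (z * g) (z * h) = separation g h.
Proof.
rewrite /separation [RHS](perm_big [seq rG z^-1%g *m x | x <- Psi]) /=.
  by rewrite big_map; apply: eq_bigr => x _; rewrite !sgn_act invgK.
apply: uniq_perm; rewrite ?undup_uniq // ?map_inj_uniq ?undup_uniq //.
  by move=> x y /eqP; rewrite rG_inj_vec => /eqP.
move=> x; apply/idP/mapP => [hx|[y hy ->]]; last by rewrite mem_rG.
by exists (rG z *m x); rewrite ?mem_rG // -rG_M mulVg rG_1.
Qed.

Lemma separationE g h : separation g h = (cox_length S (g^-1 * h)).*2.
Proof. by rewrite cox_lengthE -[RHS](separation_mull _ _ g) mulg1 mulKVg. Qed.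

Lemma eq_sgn g h : {in Psi, sgn g =1 sgn h} -> g = h.
Proof.
move=> e; have [k hk ek] := reduced_word (g^-1 * h).
move: ek; rewrite -(separation_mull _ _ g) mulg1 mulKVg /separation big1_seq => [|x /= hx].
  case: k hk => // + _; rewrite expg0 inE => /eqP e1.
  by rewrite -[h](mulKVg g) e1 mulg1.
by rewrite e // addbb.
Qed.

(** The equality of lengths is the case of equality in the triangle inequality for [separation],
    which can be read off root by root. *)
Lemma weak_leP u w :
  reflect {in Psi, forall x, sgn u x = sgn 1 x \/ sgn u x = sgn w x} (weak_le S u w).
Proof.
rewrite /weak_le -(inj_eq double_inj) doubleD -separationE !cox_lengthE.
rewrite {2 3}/separation -big_split /= eq_sum_nat => [|x _]; last first.
  by case: (sgn 1 x); case: (sgn u x); case: (sgn w x).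
apply: (iffP allP) => h x /h.
  by case: (sgn 1 x); case: (sgn u x); case: (sgn w x) => //= _; auto.
by case=> ->; case: (sgn 1 x); case: (sgn w x).
Qed.

(** The corners are in cyclic order: [o] is opposite to [c], and [b] to [a]. *)
Definition rectangle c a o b : Prop := {in Psi, forall x,
  (sgn c x = sgn a x /\ sgn b x = sgn o x) \/
  (sgn c x = sgn b x /\ sgn a x = sgn o x)}.

(** For [u] and [v] below [w], a root separating [u] from [v] also separates [1] from [w]; equal
    distances force the converse. *)
Lemma diameter_rectangle w u v : is_diameter S w u v -> rectangle 1 u w v.
Proof.
case; rewrite !inE => /andP[_ /weak_leP hu] /andP[_ /weak_leP hv].
rewrite /word_dist => /(congr1 double); rewrite -separationE cox_lengthE => /eqP.
rewrite /separation eq_sum_nat => [/allP h x hx|x hx]; last first.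
  by case: (hu x hx) => ->; case: (hv x hx) => ->; case: (sgn 1 x); case: (sgn w x).
move: (h x hx); case: (hu x hx) => ->; case: (hv x hx) => ->;
  by case: (sgn 1 x); case: (sgn w x) => //; auto.
Qed.

(** The chamber across a wall of [u] that separates it from [z] lies between [u] and [z], so it is
    [z] for a cover. Conversely, adjacent chambers differ in the sign of one root and its opposite
    only, so nothing lies strictly between them. *)
Lemma weak_covered_rightP u z : reflect
  (exists d, [/\ d \in Delta, z = (u * root_refl d)%g & sgn 1 (rG u *m d)])
  (weak_covered S u z).
Proof.
apply: (iffP and3P) => [[uz /weak_leP le /forallP cov]|[d [hd -> sd]]].
  (* Otherwise all roots positive on [u], being non-negative combinations of the [rG u *m d], are
     positive on [z], and [u = z]. *)
  have [d hd sd] : exists2 d, d \in Delta & ~~ sgn z (rG u *m d).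
    apply: contrapT => nd; move/eqP: uz; apply; apply: eq_sgn.
    have pos x : x \in Psi -> sgn u x -> sgn z x.
      move=> hx; rewrite sgnE => hs.
      have hy : rG u^-1%g *m x \in Psi by rewrite mem_rG.
      have [c ec] := sgn1_comb hy hs.
      have ez : x = \sum_(a <- Delta) (c a)%:R *: (rG u *m a).
        rewrite -[x](rG_1 rG) -(mulgV u) rG_M ec mulmx_sumr.
        by apply: eq_bigr => a _; rewrite scalemxAr.
      rewrite /sgn lt0r chamber_neq0 //= ez dotp_sumr big_seq sumr_ge0 // => a ha.
      rewrite dotpZr mulr_ge0 ?ler0n // ltW //; apply: contrapT => na.
      by apply: nd; exists a => //; apply/negP.
    move=> x hx; apply/idP/idP; first exact: pos.
    by apply: contraLR; rewrite -!sgn_opp // => /pos; apply; rewrite (mem_rootN sysPsi).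
  have hdP := subDelta hd; have hb : rG u *m d \in Psi by rewrite mem_rG.
  have su : sgn u (rG u *m d) by rewrite sgn_self.
  have s1 : sgn 1 (rG u *m d).
    by case: (le _ hb) => e; [rewrite -e|rewrite -e su in sd].
  exists d; split=> //; have := cov (u * root_refl d)%g; move/implyP.
  case/(_ _)/orP => [|/eqP e|/eqP->//]; last first.
    have := sgn_mul_simple u hd hb; rewrite e eqxx su //=.
  apply/andP; split; apply/weak_leP => x hx; rewrite sgn_mul_simple //.
    case: (eqVneq x (rG u *m d)) => [->|xb]; first by left; rewrite su s1.
    case: (eqVneq x (- (rG u *m d))) => [->|xNb] /=; last by right; rewrite addbF.
    by left; rewrite !sgn_opp // su s1.
  case: (eqVneq x (rG u *m d)) => [->|xb]; first by right; rewrite su (negPf sd).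
  case: (eqVneq x (- (rG u *m d))) => [->|xNb] /=.
    by right; rewrite !sgn_opp // su (negPf sd).
  by rewrite addbF; apply: le.
have hdP := subDelta hd; have hb : rG u *m d \in Psi by rewrite mem_rG.
have su : sgn u (rG u *m d) by rewrite sgn_self.
split.
- apply/eqP => e; have := sgn_mul_simple u hd hb.
  by rewrite -e su eqxx.
- apply/weak_leP => x hx; rewrite sgn_mul_simple //.
  case: (eqVneq x (rG u *m d)) => [->|xb]; first by left; rewrite su sd.
  case: (eqVneq x (- (rG u *m d))) => [->|xNb] /=; last by right; rewrite addbF.
  by left; rewrite !sgn_opp // su sd.
apply/forallP => y; apply/implyP => /andP[/weak_leP uy /weak_leP yz].
have off x : x \in Psi -> x != rG u *m d -> x != - (rG u *m d) -> sgn y x = sgn u x.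
  move=> hx xb xNb; case: (uy x hx) => // e; case: (yz x hx).
    by rewrite e.
  by rewrite sgn_mul_simple // (negPf xb) (negPf xNb) addbF.
case yb : (sgn y (rG u *m d)); apply/orP; [left|right]; apply/eqP; apply: eq_sgn => x hx.
  case: (eqVneq x (rG u *m d)) => [->|xb]; first by rewrite yb su.
  case: (eqVneq x (- (rG u *m d))) => [->|xNb]; last exact: off.
  by rewrite !sgn_opp // yb su.
rewrite sgn_mul_simple //; case: (eqVneq x (rG u *m d)) => [->|xb] /=.
  by rewrite yb su.
case: (eqVneq x (- (rG u *m d))) => [->|xNb] /=; last by rewrite addbF off.
by rewrite !sgn_opp // yb su.
Qed.

(** This is [D c g]: the roots [rG g *m d] define the walls of the chamber of [g] and are positive
    on it. *)
Definition walls c g : nat := count (fun d => ~~ sgn c (rG g *m d)) Delta.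

Lemma card_simple_image (f : 'cV[R]_n -> W) (P : pred 'cV[R]_n) (A : {set W}) :
    {in Delta &, injective f} ->
    (forall z, reflect (exists d, [/\ d \in Delta, z = f d & P d]) (z \in A)) ->
  #|A| = count P Delta.
Proof.
move=> fi hA; rewrite -size_filter -(size_map f).
have <- : #|[seq f d | d <- Delta & P d]| = size [seq f d | d <- Delta & P d].
  apply/card_uniqP; rewrite map_inj_in_uniq ?filter_uniq ?free_uniq // => d e.
  by rewrite !mem_filter => /andP[_ hd] /andP[_ he]; apply: fi.
apply: eq_card => x; apply/hA/mapP => [[d [hd -> pd]]|[d]].
  by exists d; rewrite ?mem_filter ?pd.
by rewrite mem_filter => /andP[pd hd] ->; exists d.
Qed.

(** As [u] is below [w], a wall of [u] separating it from [w] does not separate it from [1].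
    Crossing it therefore goes up and stays below [w]. *)
Lemma atomE u w : weak_le S u w -> atom S u w = walls w u.
Proof.
move=> /weak_leP le; apply: (card_simple_image (f := fun d => (u * root_refl d)%g)).
  by move=> d e hd he /mulgI; apply: root_refl_inj.
move=> x; rewrite !inE; apply: (iffP andP) => [[/andP[_ /weak_leP xw] /weak_covered_rightP[d [hd e s1]]]|].
  have hb : rG u *m d \in Psi by rewrite mem_rG subDelta.
  exists d; split=> //; case: (xw _ hb); rewrite e sgn_mul_simple // eqxx sgn_self //= ?s1 //.
  by move <-.
case=> d [hd e sw]; have hb : rG u *m d \in Psi by rewrite mem_rG subDelta.
have s1 : sgn 1 (rG u *m d).
  by case: (le _ hb) => es; [rewrite -es sgn_self|rewrite -es sgn_self in sw].
have cov : weak_covered S u x by apply/weak_covered_rightP; exists d.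
split=> //; case/and3P: cov => _ -> _; rewrite /=.
apply/weak_leP => y hy; rewrite e sgn_mul_simple //.
case: (eqVneq y (rG u *m d)) => [->|yb]; first by right; rewrite sgn_self // (negPf sw).
case: (eqVneq y (- (rG u *m d))) => [->|yNb] /=.
  by right; rewrite !sgn_opp // sgn_self // (negPf sw).
by rewrite addbF; apply: le.
Qed.

Lemma coatomE w : coatom S 1 w = walls 1 w.
Proof.
apply: (card_simple_image (f := fun d => (w * root_refl d)%g)).
  by move=> d e hd he /mulgI; apply: root_refl_inj.
move=> x; rewrite !inE; apply: (iffP andP) => [[_ /weak_covered_rightP[d [hd e s1]]]|].
  have hdP := subDelta hd; exists d; split=> //.
    by rewrite e -mulgA root_reflK // mulg1.
  by rewrite e rG_M root_reflE // refl_self // rGN sgn_opp ?mem_rG ?negbK.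
case=> d [hd e sw]; have hdP := subDelta hd.
have cov : weak_covered S x w.
  apply/weak_covered_rightP; exists d; rewrite e -mulgA root_reflK // mulg1; split=> //.
  by rewrite rG_M root_reflE // refl_self // rGN sgn_opp ?mem_rG ?negbK.
split=> //; case/and3P: cov => _ -> _; rewrite andbT.
by apply/weak_leP => y _; left.
Qed.

(** * The corner inequality and the equalities in a rectangle *)

Lemma root_reflections : {in Psi, forall s, exists g, rG g = reflection_mx s}.
Proof. by move=> s hs; exists (root_refl s); rewrite root_reflE. Qed.

(** [balanced_bound] for the chambers [a], [b] and [- o] seen from [c]. Of the [n] simple roots of
    [- o], those negative on [c] number [n - walls c o]. *)
Lemma walls_corner c a o b : rectangle c a o b ->
  (walls c a + walls c b <= walls c o)%N.
Proof.
move=> rect.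
pose gg (i : 'I_3) := nth 1%g [:: a; b; o] i.
pose sc (i : 'I_3) : R := if val i == 2%N then -1 else 1.
have scK i : sc i * sc i = 1 by rewrite /sc; case: ifP => _; rewrite ?mulrNN mulr1.
pose p i := sc i *: (rG (gg i) *m q0).
pose t i := [seq sc i *: (rG (gg i) *m d) | d <- Delta].
pose i0 := @Ordinal 3 0 isT; pose i1 := @Ordinal 3 1 isT; pose i2 := @Ordinal 3 2 isT.
have I3 (P : 'I_3 -> Prop) : P i0 -> P i1 -> P i2 -> forall i, P i.
  move=> P0 P1 P2 [[|[|[|//]]] hi].
  - by rewrite (_ : Ordinal hi = i0) //; apply: val_inj.
  - by rewrite (_ : Ordinal hi = i1) //; apply: val_inj.
  by rewrite (_ : Ordinal hi = i2) //; apply: val_inj.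
(* If [c] agrees with both [a] and [b] on [x], it agrees with [o], so only [- o] differs from it.
   Otherwise exactly one of [a] and [b] differs from [c], and so does [o], hence [- o] agrees with
   [c]. *)
pose col x := if sgn c x != sgn a x then i0 else if sgn c x != sgn b x then i1 else i2.
have scP i x : (sc i *: x \in Psi) = (x \in Psi).
  by rewrite /sc; case: ifP => _; rewrite ?scaleN1r ?scale1r // (mem_rootN sysPsi).
have pE i x : dotp (p i) x = dotp (rG (gg i) *m q0) (sc i *: x).
  by rewrite dotpZl dotpZr.
have colP : sign_coloring Psi (rG c *m q0) p col.
  split=> [x /(chamber_neq0 c) //|x hx i|x hx i].
    by rewrite pE chamber_neq0 // scP.
  rewrite pE -/(sgn _ _) -[0 < dotp (rG c *m q0) x]/(sgn c x) /col.
  move: i; apply: I3; rewrite /sc /gg /= ?scale1r ?scaleN1r ?sgn_opp //;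
    move: (rect x hx); case: (sgn c x); case: (sgn a x); case: (sgn b x);
    by case: (sgn o x) => //= -[] [].
have [la [la0 lap]] := balanced_vectors orthG (undup_uniq Phi) sysPsi colP root_reflections.
have tP i : {subset t i <= Psi}.
  by move=> _ /mapP[d hd ->]; rewrite scP mem_rG subDelta.
have tpos i : {in t i, forall d, 0 < dotp (p i) d}.
  by move=> _ /mapP[d hd ->]; rewrite pE scalerA scK scale1r; apply: sgn_self.
have tfree i : free (t i).
  have /choice[q hq] d : exists q, d \in Delta ->
      {in Delta, forall e, dotp q e = (e == d)%:R}.
    case: (boolP (d \in Delta)) => [hd|_]; last by exists 0.
    by have [q hq] := dual_vector freeDelta hd; exists q.
  have dt d e : d \in Delta -> e \in Delta ->
      dotp (sc i *: (rG (gg i) *m q d)) (sc i *: (rG (gg i) *m e)) = (e == d)%:R.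
    by move=> hd he; rewrite dotpZl dotpZr mulrA scK mul1r orthG hq.
  apply: (triangular_free (q := fun d => sc i *: (rG (gg i) *m q d)) (wt := fun=> 0)).
  - exact: free_uniq.
  - by move=> d hd; rewrite dt // eqxx oner_eq0.
  by move=> d e hd he; rewrite dt //; case: (eqVneq e d) => [->|_]; [left|rewrite eqxx].
have tcomb : {in Psi, forall x i, 0 < dotp (p i) x -> nonneg_comb (t i) x}.
  move=> x hx i; rewrite pE -/(sgn _ _) sgnE => sx.
  have hy : rG (gg i)^-1%g *m (sc i *: x) \in Psi by rewrite mem_rG scP.
  have [k ek] := sgn1_comb hy sx.
  exists (fun y => k (rG (gg i)^-1%g *m (sc i *: y))); rewrite big_map.
  have -> : x = sc i *: (rG (gg i) *m (rG (gg i)^-1%g *m (sc i *: x))).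
    by rewrite -rG_M mulgV rG_1 scalerA scK scale1r.
  rewrite {1}ek mulmx_sumr scaler_sumr; apply: eq_bigr => d _.
  by rewrite [sc i *: (sc i *: _)]scalerA scK scale1r -rG_M mulVg rG_1 -scalemxAr !scalerA mulrC.
have := balanced_bound sysPsi colP la0 lap tfree tP tpos tcomb.
have cnt i : count (fun d => dotp (rG c *m q0) d < 0) (t i) =
    count (fun d => ~~ sgn c (sc i *: (rG (gg i) *m d))) Delta.
  rewrite count_map; apply: eq_in_count => d hd /=.
  by rewrite /sgn -leNgt le_eqVlt (negPf (chamber_neq0 _ _)) // scP mem_rG subDelta.
rewrite (bigD1 i0) //= (bigD1 i1) //= (bigD1 i2) //= big1 => [|i]; last first.
  by move: i; apply: I3.
rewrite !cnt /sc /gg /= addn0.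
under eq_count do rewrite scale1r.
rewrite -/(walls c a); under [X in (_ + (X + _))%N]eq_count do rewrite scale1r.
rewrite -/(walls c b).
have : (walls c o + count (fun d => ~~ sgn c (-1 *: (rG o *m d))) Delta)%N = size Delta.
  rewrite -(count_predC (fun d => ~~ sgn c (rG o *m d)) Delta); congr addn.
  by apply: eq_in_count => d hd /=; rewrite scaleN1r sgn_opp // mem_rG subDelta.
by rewrite size_simple_roots => e; rewrite -[leqRHS]e addnA leq_add2r.
Qed.

(** A root positive on [a] is negative on at most one of [c] and [o], and it is negative on [b]
    exactly when it is negative on one of them. *)
Lemma walls_opposite c a o b : rectangle c a o b ->
  (walls c a + walls o a = walls b a)%N.
Proof.
move=> rect; rewrite /walls -count_predUI.
rewrite [X in (_ + X)%N](eq_in_count (a2 := pred0)) ?count_pred0 ?addn0 => [|d hd] /=.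
  apply: eq_in_count => d hd /=.
  have sa := sgn_self a hd; case: (rect (rG a *m d)).
  - by rewrite mem_rG subDelta.
  - by rewrite sa => -[-> ->].
  by rewrite sa => -[-> <-]; rewrite orbF.
have sa := sgn_self a hd; case: (rect (rG a *m d)).
- by rewrite mem_rG subDelta.
- by rewrite sa => -[-> _].
by rewrite sa => -[_ <-]; rewrite andbF.
Qed.

Lemma rectangle_rot c a o b : rectangle c a o b -> rectangle a o b c.
Proof.
by move=> h x /h [] [e1 e2]; [right; rewrite e1 e2|left; rewrite e1 e2].
Qed.

(** By the four equalities of [walls_opposite], the two sides of the four corner inequalities have
    the same total, so each inequality is an equality. *)
Lemma walls_rectangle c a o b : rectangle c a o b ->
  (walls c o = walls c a + walls c b /\ walls o c = walls o a + walls o b)%N.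
Proof.
move=> r0; have r1 := rectangle_rot r0; have r2 := rectangle_rot r1.
have r3 := rectangle_rot r2.
have := walls_corner r0; have := walls_corner r1; have := walls_corner r2.
have := walls_corner r3; have := walls_opposite r0; have := walls_opposite r1.
have := walls_opposite r2; have := walls_opposite r3.
lia.
Qed.

End WeylGroup.

Theorem corollary1p9 (R : realType) (W : finGroupType) (S : {set W})
    (hcox : coxeter_system S) (hweyl : finite_weyl_group R S)
    (w u v : W) (huv : is_diameter S w u v) :
  (atom S 1%g w = atom S u w + atom S v w)%N /\
  (coatom S 1%g w = coatom S 1%g u + coatom S 1%g v)%N.
Proof.
have [n [Phi [Delta [rG [[cryst simple] faith refl gen defS]]]]] := hweyl.
have [_ genS _] := hcox.
have [q0 q0P] := height_vector simple.
have coE := coatomE cryst simple faith refl gen q0P defS genS.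
have aE := atomE cryst simple faith refl gen q0P defS genS.
have rect := diameter_rectangle cryst simple faith refl gen q0P defS genS huv.
(* The equality at the corner [1] counts coatoms, the one at the corner [w] counts atoms. *)
have [e1 e2] := walls_rectangle cryst simple faith refl gen q0P rect.
case: huv; rewrite !inE => /andP[h1u huw] /andP[_ hvw] _.
rewrite !coE !aE //; apply/(weak_leP cryst simple faith refl gen q0P defS genS).
by move=> x _; left.
Qed.
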